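(* Let $n\geq 2$, $m,N\geq 1$, and let $A=\{\alpha_1,\ldots,\alpha_m\}$ be a set of numbers $-1<\alpha_1<\ldots<\alpha_m<1$ symmetric about the origin. Suppose there exists an antipodal equi-weighted $2N$-point $(2m-1)$-design $\widetilde C=\{\widetilde x_1,\ldots,\widetilde x_N,-\widetilde x_1,\ldots,-\widetilde x_N\}\subset \mathbb{S}^{n-1}$ with dot products between points from distinct antipodal pairs lying in $A$. Let $f:[0,1]\to \mathbb R$ be a continuous function such that $f^{(k)}\geq 0$ in $(0,1)$ for $k=1,\ldots,m$. Suppose $(C,W)=(x_1,\ldots,x_{N},-x_1,\ldots,-x_N;w_1,\ldots,w_{N},w_1,\ldots,w_N)$ is any antipodal weighted code of $2N$ distinct points on $\mathbb S^{n-1}$. Then $$E_f(C,W)=4\sum_{i,j=1}^{N}w_iw_jf\left((x_i\cdot x_j)^2\right)\geq E_f(\widetilde C,\widetilde W)=\frac {1}{N^2}\sum_{i,j=1}^{N}f\left((\widetilde x_i\cdot \widetilde x_j)^2\right),\qquad( * )$$ where $\widetilde W=\left(\frac {1}{2N},\ldots,\frac {1}{2N}\right)\in \mathbb R^{2N}$. Assume, in addition, that $f^{(k)}>0$ on $(0,1)$ for $k=1,\ldots,m$. Then equality holds in $( * )$ if and only if $(C,W)$ is an antipodal equi-weighted $2N$-point $(2m-1)$-design on $\mathbb{S}^{n-1}$ with dot products between points from distinct antipodal pairs lying in $A$.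
   Context: $\mathbb S^{n-1}$ is the unit sphere in $\mathbb R^n$ and $x\cdot y$ is the standard dot product. A weighted code $(C,W)=(y_1,\ldots,y_M;u_1,\ldots,u_M)$ on $\mathbb S^{n-1}$ consists of pairwise distinct points $y_1,\ldots,y_M\in\mathbb S^{n-1}$, $C=\{y_1,\ldots,y_M\}$, and weights $u_i>0$ with $u_1+\ldots+u_M=1$. It is equi-weighted if all weights equal $1/M$. It is antipodal if for any $x\in C$, the point $-x$ is in $C$ and the weights of $x$ and $-x$ are equal. An antipodal pair is a pair $\{x,-x\}$. $(C,W)$ is a $k$-design if for every univariate real polynomial $p$ of degree at most $k$ the sum $\sum_{i=1}^M u_i p(x\cdot y_i)$ is constant in $x\in\mathbb S^{n-1}$. An equi-weighted $k$-design is a code which is a $k$-design with all weights equal. The $f$-energy is $E_f(C,W):=\sum_{i,j=1}^{M}u_iu_jf\left((y_i\cdot y_j)^2\right)$. Conditions on $f^{(k)}$ on $(0,1)$ include the existence of these derivatives there. *)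

(* Defs.v *)
From HB Require Import structures.
From mathcomp Require Import all_boot all_order all_algebra.
From mathcomp Require Import all_classical all_reals all_analysis.
Import numFieldNormedType.Exports.

Set Implicit Arguments.
Unset Strict Implicit.
Unset Printing Implicit Defensive.

Import Order.TTheory GRing.Theory Num.Theory.
Local Open Scope classical_set_scope.
Local Open Scope ring_scope.

Definition dotv (R : realType) (n : nat) (x y : 'rV[R]_n) : R :=
  \sum_(k < n) x 0 k * y 0 k.

(* The library norm on ['rV[R]_n] is the sup norm, so the Euclidean sphere is
   written with the dot product. *)
Definition sphere (R : realType) (n : nat) : set 'rV[R]_n :=
  [set x | dotv x x = 1].

(* An M-point family (y_1, ..., y_M; u_1, ..., u_M) is encoded by the matrix Y
   whose i-th row is y_i and by the row vector u of weights. *)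
Definition weighted_code (R : realType) (n M : nat)
    (Y : 'M[R]_(M, n)) (u : 'rV[R]_M) : Prop :=
  [/\ forall i, sphere (row i Y),
      injective (fun i => row i Y),
      forall i, 0 < u 0 i
    & \sum_i u 0 i = 1].

Definition equi_weighted (R : realType) (M : nat) (u : 'rV[R]_M) : Prop :=
  forall i, u 0 i = M%:R^-1.

Definition antipodal (R : realType) (n M : nat)
    (Y : 'M[R]_(M, n)) (u : 'rV[R]_M) : Prop :=
  forall i, exists j, row j Y = - row i Y /\ u 0 j = u 0 i.

(* [size p <= k.+1] says that p has degree at most k. *)
Definition is_design (R : realType) (n M k : nat)
    (Y : 'M[R]_(M, n)) (u : 'rV[R]_M) : Prop :=
  forall p : {poly R}, (size p <= k.+1)%N ->
    exists c : R, forall x : 'rV[R]_n, sphere x ->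
      \sum_i u 0 i * p.[dotv x (row i Y)] = c.

Definition distinct_pair_dots_in (R : realType) (n M : nat) (A : seq R)
    (Y : 'M[R]_(M, n)) : Prop :=
  forall i j, row i Y <> row j Y -> row i Y <> - row j Y ->
    dotv (row i Y) (row j Y) \in A.

Definition antipodal_equi_weighted_design (R : realType) (n M k : nat)
    (A : seq R) (Y : 'M[R]_(M, n)) (u : 'rV[R]_M) : Prop :=
  [/\ weighted_code Y u, antipodal Y u, equi_weighted u,
      is_design k Y u & distinct_pair_dots_in A Y].

Definition energy (R : realType) (n M : nat) (f : R -> R)
    (Y : 'M[R]_(M, n)) (u : 'rV[R]_M) : R :=
  \sum_i \sum_j u 0 i * u 0 j * f (dotv (row i Y) (row j Y) ^+ 2).

(* Main.v *)
Require Import Defs.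
From HB Require Import structures.
From mathcomp Require Import all_boot all_order all_algebra.
From mathcomp Require Import all_classical all_reals all_analysis.
From mathcomp Require Import ring lra zify.
Import numFieldNormedType.Exports.
Import Order.TTheory GRing.Theory Num.Theory.
Set Implicit Arguments.
Unset Strict Implicit.
Unset Printing Implicit Defensive.
Local Open Scope ring_scope.

(** A code together with its antipodes is treated as a configuration of [N]
    points with weights [W i = 2 w i] of sum 1, on which every relevant kernel is
    a function of the square of the dot product.  The proof is the linear
    programming method of Cohn and Kumar, with all the harmonic analysis done by
    averaging over the given design.

    Let [H] be the polynomial of degree less than [m] that interpolates [f] at the
    squares of the elements of [A], to second order except at 0.  The remainder
    formula [newton_remainder] and the sign of the [m]-th derivative give
    [f >= H] on [[0, 1]], with equality at the nodes.  By the same argument in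
    lower order ([newton_expansion]), the coefficients of [H] on Newton's partial
    products are nonnegative, except perhaps the constant term.  If each partial
    product is a positive definite kernel on the sphere, then its energy is
    smallest for a design ([pair_sum_gap]).  Hence
    [E_f >= E_H + (f 1 - H 1) * sum of the W i ^ 2], and the right-hand side is
    smallest for the given design, for which this inequality is an equality
    ([energy_decomposition]).

    Positive definiteness of the partial products rests on three facts.  First, a
    partial product in [t^2] is a product of two kernels [t^e F (t^2)], where [F] is
    the product of [X - b] over the smallest squares [b] and [e] tells whether 0
    is in [A].  Next, the dot products of one point of the design with the others
    form a measure carried by the nodes and by 1, for which such an [F] is a
    nonnegative combination of orthogonal polynomials ([quad_node_prod_ge0]).  Last,
    these orthogonal polynomials, which are the Gegenbauer polynomials, are positive
    definite ([posdef_monic_orth]).  The reason is that averaging over the design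
    defines a convolution of zonal polynomials, of which the polynomials of bounded
    degree are ideals, and convolution is self-adjoint; so convolution by the
    reproducing kernel of a bounded degree is an orthogonal projection, and the
    monomial kernels [(x . y)^k] are visibly positive definite.

    In the case of equality with strict signs, each term of the decomposition
    vanishes: the dot products are nodes, the weights are uniform, and the gaps of
    all partial products are zero, which forces the design property.  Conversely,
    two designs of this kind bound each other's energies. *)

(** * Orthogonal polynomials of a discrete measure *)

Definition quad (R : realType) (M : nat) (om s : 'I_M -> R)
    (q : {poly R}) : R := \sum_j om j * q.[s j].

Definition quad_definite (R : realType) (M : nat) (om s : 'I_M -> R)
    (k : nat) : Prop :=
  forall q : {poly R}, (size q <= k)%N -> quad om s (q * q) = 0 -> q = 0.

Definition quad_orth (R : realType) (M : nat) (om s : 'I_M -> R)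
    (k : nat) (q : {poly R}) : Prop :=
  forall r : {poly R}, (size r <= k)%N -> quad om s (q * r) = 0.

Definition monic_orth (R : realType) (M : nat) (om s : 'I_M -> R)
    (k : nat) (q : {poly R}) : Prop :=
  [/\ q \is monic, size q = k.+1 & quad_orth om s k q].

Section Quadrature.
Context {R : realType} {M : nat} (om s : 'I_M -> R).
Implicit Types q p r : {poly R}.

Lemma quadD p q : quad om s (p + q) = quad om s p + quad om s q.
Proof. by rewrite -big_split; apply: eq_bigr => j _; rewrite hornerD mulrDr. Qed.

Lemma quadZ c p : quad om s (c *: p) = c * quad om s p.
Proof. by rewrite /quad big_distrr; apply: eq_bigr => j _; rewrite hornerZ mulrCA. Qed.

Lemma quadN p : quad om s (- p) = - quad om s p.
Proof. by rewrite -scaleN1r quadZ mulN1r. Qed.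

Lemma quadB p q : quad om s (p - q) = quad om s p - quad om s q.
Proof. by rewrite quadD quadN. Qed.

Hypothesis om0 : forall j, 0 <= om j.

Lemma quad_sqr_ge0 q : 0 <= quad om s (q * q).
Proof. by apply: sumr_ge0 => j _; rewrite hornerM mulr_ge0 // -expr2 sqr_ge0. Qed.

Lemma quad_sqr_gt0 k q : quad_definite om s k -> (size q <= k)%N -> q != 0 ->
  0 < quad om s (q * q).
Proof.
move=> df sq q0; rewrite lt_def quad_sqr_ge0 andbT.
by apply: contra q0 => /eqP /df -> //.
Qed.

Lemma quad_sqr_eq0 q : quad om s (q * q) = 0 -> forall j, om j * q.[s j] = 0.
Proof.
move=> /eqP; rewrite psumr_eq0 => [/allP h j|j _]; last first.
  by rewrite hornerM mulr_ge0 // -expr2 sqr_ge0.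
have /h : j \in index_enum 'I_M by rewrite mem_index_enum.
by rewrite /= hornerM !mulf_eq0 orbb => h'; apply/eqP; rewrite mulf_eq0.
Qed.

Lemma quad_sqr_eq0_mul q p : quad om s (q * q) = 0 -> quad om s (p * q) = 0.
Proof.
move=> /quad_sqr_eq0 h; rewrite /quad big1 // => j _.
by rewrite hornerM mulrCA h mulr0.
Qed.

Lemma monic_sub_size (q p : {poly R}) (k : nat) :
  q \is monic -> size q = k.+1 -> (size p <= k.+1)%N ->
  (size (p - p`_k *: q)%R <= k)%N.
Proof.
move=> mq sq sp; apply/leq_sizeP => j kj.
rewrite coefB coefZ; case: (ltngtP j k) kj => // [kj _|-> _]; last first.
  by move: mq; rewrite monicE lead_coefE sq /= => /eqP ->; rewrite mulr1 subrr.
rewrite [p`_j]nth_default ?[q`_j]nth_default ?mulr0 ?subrr // ?sq //.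
exact: leq_trans sp _.
Qed.

Lemma monic_split (q p : {poly R}) (k : nat) :
  q \is monic -> size q = k.+1 -> (size p <= k.+1)%N ->
  exists c r, p = c *: q + r /\ (size r <= k)%N.
Proof.
move=> mq sq sp; exists p`_k, (p - p`_k *: q).
by rewrite addrC subrK; split=> //; apply: monic_sub_size.
Qed.

Lemma monic_orth_size_sub k q : monic_orth om s k q -> (size ('X^k - q)%R <= k)%N.
Proof.
move=> [mq sq _]; have := monic_sub_size (p := 'X^k) mq sq.
by rewrite size_polyXn coefXn eqxx scale1r; apply.
Qed.

Lemma monic_orth_sub (k : nat) (S : {poly R}) : (size S <= k)%N ->
  (forall r : {poly R}, (size r <= k)%N ->
    quad om s (S * r) = quad om s ('X^k * r)) ->
  monic_orth om s k ('X^k - S).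
Proof.
move=> sS hS; have sQ : size ('X^k - S)%R = k.+1.
  by rewrite size_polyDl size_polyXn // size_polyN ltnS.
split=> //.
  by rewrite monicE lead_coefE sQ coefB coefXn eqxx [S`_k]nth_default ?subr0.
by move=> r sr; rewrite mulrBl quadB hS // subrr.
Qed.

(** Riesz representation, proved by induction on the dimension.  Orthogonal
    polynomials are the case where the form is the product with ['X^k]; the
    unit of the convolution below is the case where it is the value at 1. *)
Lemma quad_riesz k (l : {poly R} -> R) :
  (forall p q, l (p + q) = l p + l q) -> (forall c p, l (c *: p) = c * l p) ->
  quad_definite om s k ->
  exists K : {poly R}, (size K <= k)%N /\
    forall r, (size r <= k)%N -> quad om s (K * r) = l r.
Proof.
move=> lD lZ; elim: k l lD lZ => [|k IH] l lD lZ df.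
  exists 0; split; first by rewrite size_poly0.
  move=> r; rewrite leqn0 size_poly_eq0 => /eqP ->.
  by rewrite mul0r -(scale0r 0) quadZ lZ !mul0r.
have df' : quad_definite om s k by move=> q sq; apply: df; apply: leqW.
have [S [sS hS]] := IH (fun r => quad om s ('X^k * r))
  (fun p q => ltac:(by rewrite /= mulrDr quadD))
  (fun c p => ltac:(by rewrite /= -scalerAr quadZ)) df'.
have [K [sK hK]] := IH l lD lZ df'.
have [] := monic_orth_sub sS hS; set Q : {poly R} := 'X^k - S => mQ sQ oQ.
have Q0 : Q != 0 by rewrite -size_poly_eq0 sQ.
have := quad_sqr_gt0 df (eq_leq sQ) Q0; move: Q sQ mQ oQ Q0 => Q sQ mQ oQ Q0.
set c := quad om s (Q * Q) => c0.
(* Q spans the new orthogonal direction, so K only has to be corrected along Q *)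
exists (K + (l Q / c) *: Q); split.
  apply: leq_trans (size_polyD _ _) _; rewrite geq_max (leqW sK) /=.
  by apply: leq_trans (size_scale_leq _ _) _; rewrite sQ.
move=> r sr; have [d [r' [-> sr']]] := monic_split mQ sQ sr.
rewrite mulrDl !mulrDr !quadD lD lZ -!scalerAl -!scalerAr !quadZ hK //.
have oQK : quad om s (K * Q) = 0 by rewrite mulrC oQ.
rewrite oQK (oQ r') // -/c; field.
by rewrite gt_eqF.
Qed.

Lemma exists_monic_orth k : quad_definite om s k -> exists q, monic_orth om s k q.
Proof.
move=> df; have [S [sS hS]] := @quad_riesz k (fun r => quad om s ('X^k * r))
  (fun p q => ltac:(by rewrite /= mulrDr quadD))
  (fun c p => ltac:(by rewrite /= -scalerAr quadZ)) df.
by exists ('X^k - S); apply: monic_orth_sub.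
Qed.

Lemma quad_definiteS k q : quad_definite om s k -> monic_orth om s k q ->
  quad om s (q * q) != 0 -> quad_definite om s k.+1.
Proof.
move=> df [mq sq oq] n0 r sr.
have [c [r' [-> sr']]] := monic_split mq sq sr.
have -> : (c *: q + r') * (c *: q + r') =
    (c ^+ 2) *: (q * q) + (2 * c) *: (q * r') + r' * r'.
  by rewrite -!mul_polyC; rewrite !rmorphM /=; ring.
rewrite !quadD !quadZ (oq r') // mulr0 addr0 => /eqP.
rewrite paddr_eq0 ?(mulr_ge0 (sqr_ge0 _)) ?quad_sqr_ge0 //.
rewrite mulf_eq0 (negPf n0) orbF expf_eq0 /= => /andP[/eqP c0 /eqP h].
by rewrite c0 scale0r add0r; apply: df.
Qed.

End Quadrature.

Lemma monic_size1 (R : realType) (q : {poly R}) :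
  q \is monic -> size q = 1%N -> q = 1.
Proof.
move=> mq sq; move: mq; rewrite monicE (size1_polyC (eq_leq sq)) lead_coefC.
by move/eqP->.
Qed.

Lemma size_XsubC_mul (R : realType) (b : R) (q : {poly R}) :
  q != 0 -> size (('X - b%:P) * q)%R = (size q).+1.
Proof. by move=> q0; rewrite size_mul ?polyXsubC_eq0 // size_XsubC. Qed.

(** The polynomial vanishing at the smallest nodes of a discrete measure has
    nonnegative inner products with the monic orthogonal polynomials.  Induction
    on the removed nodes: if [b] is the smallest node, then [s - b] is
    nonnegative on the nodes, so [(s - b) om] is again a nonnegative measure,
    with monic orthogonal polynomials [Q_i] say, and Christoffel's formula
    expresses [q] as [Q_k + c Q_{k-1}].  The coefficient [c] has the sign of the
    product of [q] with [('X - b) Q_{k-1}] under the old measure, which is the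
    squared norm of [q]. *)
Lemma quad_node_prod_ge0 (R : realType) (M : nat) (bs : seq R)
    (om s : 'I_M -> R) (k : nat) (q : {poly R}) :
  sorted <%R bs -> (forall j, 0 <= om j) ->
  (forall j, om j != 0 -> s j \in bs \/ {in bs, forall b, b <= s j}) ->
  quad_definite om s k -> monic_orth om s k q ->
  0 <= quad om s ((\prod_(b <- bs) ('X - b%:P)) * q).
Proof.
elim: bs om k q => [|b bs IH] om k q srt om0 supp df [mq sq oq].
  rewrite big_nil; case: k sq oq df => [|k] sq oq df.
    have -> : q = 1 by exact: monic_size1.
    exact: quad_sqr_ge0.
  by rewrite mulrC oq // size_poly1.
(* a polynomial of norm zero vanishes at all nodes of positive weight *)
have [z|nz] := eqVneq (quad om s (q * q)) 0; first by rewrite quad_sqr_eq0_mul.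
have dfS := quad_definiteS om0 df (And3 mq sq oq) nz.
pose om' j := om j * (s j - b).
have quad' p : quad om' s p = quad om s (('X - b%:P) * p).
  by apply: eq_bigr => j _; rewrite hornerM hornerXsubC /om' mulrA.
have bmin : {in bs, forall x, b < x}.
  by move: srt; rewrite /= lt_path_sortedE => /andP[/allP].
have om'0 j : 0 <= om' j.
  have [nj|nj] := eqVneq (om j) 0; first by rewrite /om' nj mul0r.
  rewrite /om' mulr_ge0 // subr_ge0; case: (supp j nj) => [|h].
    by rewrite inE => /predU1P[->|/bmin/ltW].
  by apply: h; rewrite mem_head.
have supp' j : om' j != 0 -> s j \in bs \/ {in bs, forall b, b <= s j}.
  rewrite mulf_eq0 negb_or subr_eq0 => /andP[nj sb]; case: (supp j nj) => [|h].
    by rewrite inE (negPf sb) /=; left.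
  by right=> x xb; apply: h; rewrite inE xb orbT.
have df' i : quad_definite om s i.+1 -> quad_definite om' s i.
  move=> d r sr; rewrite quad' => /eqP h.
  have h0 : quad om' s (r * r) = 0 by rewrite quad'; apply/eqP.
  suff : ('X - b%:P) * r = 0 by move/eqP; rewrite mulf_eq0 polyXsubC_eq0 => /eqP.
  apply: d.
    by have [->|r0] := eqVneq r 0; rewrite ?mulr0 ?size_poly0 // size_XsubC_mul.
  have := quad_sqr_eq0_mul om'0 (('X - b%:P) * r) h0.
  by rewrite quad' => <-; congr quad; ring.
have srt' : sorted <%R bs by apply: path_sorted srt.
have dk : quad_definite om' s k by exact: df'.
have [Q hQ] := exists_monic_orth om'0 dk.
have hQk : 0 <= quad om' s ((\prod_(b <- bs) ('X - b%:P)) * Q).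
  exact: (IH om' k Q).
rewrite big_cons -mulrA -quad'.
case: k sq oq df dfS hQ hQk dk => [|k] sq oq df dfS hQ hQk dk.
  suff -> : q = Q by [].
  have [mQ sQ _] := hQ.
  by rewrite (monic_size1 mq) // (monic_size1 mQ).
have dk' : quad_definite om' s k by move=> r sr; apply: dk; apply: leqW.
have [Q' hQ'] := exists_monic_orth om'0 dk'.
have hQk' : 0 <= quad om' s ((\prod_(b <- bs) ('X - b%:P)) * Q').
  exact: (IH om' k Q').
have [mQ sQ oQ] := hQ; have [mQ' sQ' oQ'] := hQ'.
have := monic_sub_size mQ sQ (eq_leq sq).
have -> : q`_k.+1 = 1 by have := mq; rewrite monicE lead_coefE sq /= => /eqP.
rewrite scale1r => sd.
have := monic_sub_size mQ' sQ' sd; set c := (q - Q)`_k; set r := _ - _ => sr.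
have Q'0 : Q' != 0 by rewrite -size_poly_eq0 sQ'.
have cge : 0 <= c.
  have E : quad om' s (q * Q') = c * quad om' s (Q' * Q').
    have -> : q * Q' = Q * Q' + c *: (Q' * Q') + Q' * r.
      by rewrite /r -!mul_polyC; ring.
    by rewrite !quadD quadZ oQ ?sQ' // (oQ' r) // addr0 add0r.
  have : 0 <= quad om' s (q * Q').
    rewrite quad'.
    have := monic_sub_size mq sq (p := ('X - b%:P) * Q').
    rewrite size_XsubC_mul // sQ' leqnn => /(_ erefl).
    have -> : (('X - b%:P) * Q')`_k.+1 = 1.
      have : ('X - b%:P) * Q' \is monic by rewrite monicMl // monicXsubC.
      by rewrite monicE lead_coefE size_XsubC_mul // sQ' /= => /eqP.
    rewrite scale1r; set r' := _ - _ => sr'.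
    have -> : ('X - b%:P) * (q * Q') = q * q + q * r' by rewrite /r'; ring.
    by rewrite quadD (oq r') // addr0 quad_sqr_ge0.
  by rewrite E pmulr_lge0 // (quad_sqr_gt0 om'0 dk) // sQ'.
suff -> : q = Q + c *: Q'.
  by rewrite mulrDr -scalerAr quadD quadZ addr_ge0 // mulr_ge0.
suff r0 : r = 0 by move/eqP: r0; rewrite subr_eq0 subr_eq addrC => /eqP.
apply: dk'; first exact: sr.
have {1}-> : r = q - Q - c *: Q' by [].
rewrite !mulrBl !quadB -scalerAl quadZ oQ ?(leqW sr) // oQ' // mulr0 !subr0 quad' mulrCA oq //.
by have [->|r0] := eqVneq r 0; rewrite ?mulr0 ?size_poly0 // size_XsubC_mul.
Qed.


(** * The Euclidean sphere *)

Section Dot.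
Context {R : realType} {n : nat}.
Implicit Types x y v : 'rV[R]_n.

Lemma dotvC x y : dotv x y = dotv y x.
Proof. by apply: eq_bigr => k _; rewrite mulrC. Qed.

Lemma dotvDl x y v : dotv (x + y) v = dotv x v + dotv y v.
Proof. by rewrite -big_split; apply: eq_bigr => k _; rewrite mxE mulrDl. Qed.

Lemma dotvZl c x v : dotv (c *: x) v = c * dotv x v.
Proof. by rewrite /dotv big_distrr /=; apply: eq_bigr => k _; rewrite mxE mulrA. Qed.

Lemma dotvNl x v : dotv (- x) v = - dotv x v.
Proof. by rewrite -scaleN1r dotvZl mulN1r. Qed.

Lemma dotvDr x y v : dotv v (x + y) = dotv v x + dotv v y.
Proof. by rewrite dotvC dotvDl !(dotvC v). Qed.

Lemma dotvZr c x v : dotv v (c *: x) = c * dotv v x.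
Proof. by rewrite dotvC dotvZl dotvC. Qed.

Lemma dotvNr x v : dotv v (- x) = - dotv v x.
Proof. by rewrite dotvC dotvNl dotvC. Qed.

Lemma dotv_ge0 x : 0 <= dotv x x.
Proof. by apply: sumr_ge0 => k _; rewrite -expr2 sqr_ge0. Qed.

Lemma dotv_eq0 x : dotv x x = 0 -> x = 0.
Proof.
move=> /eqP; rewrite psumr_eq0 => [/allP h|k _]; last by rewrite -expr2 sqr_ge0.
apply/rowP => k; rewrite mxE; apply/eqP.
have /h : k \in index_enum 'I_n by rewrite mem_index_enum.
by rewrite /= mulf_eq0 orbb.
Qed.

Lemma sphere_normalize v : v != 0 -> sphere ((Num.sqrt (dotv v v))^-1 *: v).
Proof.
move=> v0; have d0 : 0 < dotv v v.
  by rewrite lt_def dotv_ge0 andbT; apply: contra v0 => /eqP/dotv_eq0->.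
rewrite /sphere /= dotvZl dotvZr mulrA -expr2 exprVn sqr_sqrtr ?ltW //.
by rewrite mulVf ?gt_eqF.
Qed.

Lemma sphere_dot_lt1 x y : sphere x -> sphere y -> x <> y -> x <> - y ->
  -1 < dotv x y < 1.
Proof.
rewrite /sphere /= => hx hy xy xNy.
have P (u : 'rV[R]_n) : u != 0 -> 0 < dotv u u.
  by move=> u0; rewrite lt_def dotv_ge0 andbT; apply: contra u0 => /eqP/dotv_eq0->.
have /P : x - y != 0 by rewrite subr_eq0; apply/eqP.
have /P : x + y != 0 by rewrite addr_eq0; apply/eqP.
rewrite !dotvDl !dotvDr !dotvNl !dotvNr hx hy (dotvC y x) => a b.
by apply/andP; split; lra.
Qed.

(** A vector orthogonal to [z] is taken in the kernel of the [n]-by-1 matrix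
    [z^T], which is nonzero because [n >= 2]. *)
Lemma sphere_dot_surj (z : 'rV[R]_n) (t : R) : (2 <= n)%N -> sphere z ->
  t ^+ 2 <= 1 -> exists x, sphere x /\ dotv x z = t.
Proof.
move=> n2 hz t1.
have [v [v0 vz]] : exists v : 'rV[R]_n, v != 0 /\ dotv v z = 0.
  exists (nz_row (kermx z^T)); split.
    rewrite nz_row_eq0 -mxrank_eq0 mxrank_ker -lt0n subn_gt0.
    by apply: leq_ltn_trans (rank_leq_col _) _.
  have /sub_kermxP h := nz_row_sub (kermx z^T).
  have := congr1 (fun A : 'M[R]_1 => A 0 0) h; rewrite mxE /= [RHS]mxE => <-.
  by apply: eq_bigr => k _; rewrite [z^T _ _]mxE.
have [u [hu uz]] : exists u, sphere u /\ dotv u z = 0.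
  by eexists; split; [exact: sphere_normalize v0 | rewrite dotvZl vz mulr0].
move: hu hz; rewrite /sphere /= => hu hz.
exists (t *: z + Num.sqrt (1 - t ^+ 2) *: u); rewrite /sphere /=.
rewrite !dotvDl !dotvDr !dotvZl !dotvZr hu hz (dotvC z u) uz; split; last by ring.
rewrite !mulr0 add0r addr0 !mulr1 -!expr2 sqr_sqrtr ?subr_ge0 //; ring.
Qed.

End Dot.

(** * Positive definite kernels *)

(** Positive definiteness of [h (x . y)] on the sphere, as the existence of a
    finite feature map.  In this form closure under products is the tensor
    product of feature maps, and a vanishing energy makes every feature vanish. *)
Definition posdef_kernel (R : realType) (n : nat) (h : R -> R) : Prop :=
  exists (D : finType) (g : D -> 'rV[R]_n -> R), forall x y,
    sphere x -> sphere y -> h (dotv x y) = \sum_d g d x * g d y.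

Section Posdef.
Context {R : realType} {n : nat}.
Notation pd := (@posdef_kernel R n).

Lemma posdef_ext h1 h2 : h1 =1 h2 -> pd h1 -> pd h2.
Proof.
by move=> h [D [g hg]]; exists D, g => x y hx hy; rewrite -h hg.
Qed.

Lemma posdef_const c : 0 <= c -> pd (fun=> c).
Proof.
move=> c0; exists unit, (fun _ _ => Num.sqrt c) => x y _ _.
by rewrite big_const card_unit /= addr0 -expr2 sqr_sqrtr.
Qed.

Lemma posdefD h1 h2 : pd h1 -> pd h2 -> pd (fun t => h1 t + h2 t).
Proof.
move=> [D1 [g1 H1]] [D2 [g2 H2]].
exists (D1 + D2)%type, (fun d => match d with inl d => g1 d | inr d => g2 d end).
by move=> x y hx hy; rewrite big_sumType /= H1 // H2.
Qed.

Lemma posdefM h1 h2 : pd h1 -> pd h2 -> pd (fun t => h1 t * h2 t).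
Proof.
move=> [D1 [g1 H1]] [D2 [g2 H2]].
exists (D1 * D2)%type, (fun d x => g1 d.1 x * g2 d.2 x) => x y hx hy.
rewrite H1 // H2 // big_distrlr /= pair_big.
by apply: eq_bigr => d _; rewrite mulrACA.
Qed.

Lemma posdef_exp k : pd (fun t => t ^+ k).
Proof.
elim: k => [|k IH]; first by apply: posdef_ext (posdef_const ler01) => t; rewrite expr0.
apply: (@posdef_ext (fun t => t * t ^+ k)) => [t|]; first by rewrite exprS.
by apply: posdefM => //; exists 'I_n, (fun k x => x 0 k).
Qed.

End Posdef.

(** Polynomials in [t] having the parity of [e], as [t^e q(t^2)].  The
    configurations are antipodal, so everything is a function of [t^2]; the case
    [e = true] serves the sets of dot products containing 0. *)
Definition parity_eval (R : realType) (e : bool) (q : {poly R}) (t : R) : R :=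
  t ^+ e * q.[t ^+ 2].

Section ParityEval.
Context {R : realType}.
Implicit Types (q r : {poly R}) (e : bool).

Lemma parity_evalD e q r t : parity_eval e (q + r) t = parity_eval e q t + parity_eval e r t.
Proof. by rewrite /parity_eval hornerD mulrDr. Qed.

Lemma parity_evalZ e c q t : parity_eval e (c *: q) t = c * parity_eval e q t.
Proof. by rewrite /parity_eval hornerZ mulrCA. Qed.

Lemma parity_evalE e q t : parity_eval e q t = \sum_(i < size q) q`_i * t ^+ (2 * i + e).
Proof.
rewrite /parity_eval horner_coef big_distrr; apply: eq_bigr => i _ /=.
by rewrite -exprM exprD; ring.
Qed.

Lemma parity_evalXn e k (t : R) : parity_eval e 'X^k t = t ^+ (2 * k + e).
Proof. by rewrite /parity_eval hornerXn -exprM exprD mulrC. Qed.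

(** The points [1 / (k + 2)] are an infinite subset of the open unit interval. *)
Lemma poly_horner_inj (p q : {poly R}) (S : R -> Prop) :
  (forall k : nat, S (k.+2%:R^-1)) -> (forall t, S t -> p.[t] = q.[t]) -> p = q.
Proof.
move=> hS h; apply/eqP; rewrite -subr_eq0; apply/negP => /negP pq0.
pose rs := [seq (k.+2%:R^-1 : R) | k <- iota 0 (size (p - q))].
have := max_poly_roots pq0 (rs := rs).
rewrite size_map size_iota ltnn => H; suff : false by [].
apply: H.
  apply/allP => _ /mapP[k _ ->].
  by rewrite /root hornerD hornerN h ?subrr.
rewrite map_inj_uniq ?iota_uniq // => i j /invr_inj /eqP.
by rewrite eqr_nat => /eqP [].
Qed.

Lemma parity_eval_eq0 e q : (forall t, t ^+ 2 <= 1 -> parity_eval e q t = 0) -> q = 0.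
Proof.
move=> h; apply: (@poly_horner_inj _ _ (fun s => 0 < s <= 1)) => [k|s /andP[s0 s1]].
  by rewrite invr_gt0 ltr0n /= invf_le1 ?ltr0n // ler1n.
have hs : Num.sqrt s ^+ 2 = s by rewrite sqr_sqrtr // ltW.
have := h (Num.sqrt s); rewrite /parity_eval hs horner0 => /(_ s1) /eqP.
by rewrite mulf_eq0 expf_eq0 sqrtr_eq0 leNgt s0 andbF => /eqP.
Qed.

(** In [(1 + 2 t X + X^2)^k] the coefficient of [X^b] has the parity of [b] and
    degree at most [b] as a polynomial in [t]. *)
Lemma gegenbauer_gen_coef k b : exists A : {poly R},
  (size A <= b./2.+1)%N /\
  forall t, ((1 + (2 * t) *: 'X + 'X^2) ^+ k)`_b = parity_eval (odd b) A t.
Proof.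
elim: k b => [|k IH] b.
  exists (b == 0%N)%:R%:P; split; first by rewrite size_polyC; case: eqVneq => _; rewrite ?oner_eq0 ?eqxx.
  by move=> t; rewrite expr0 coef1 /parity_eval hornerC; case: b => [|b] /=; rewrite ?mulr0 ?expr0 ?mulr1.
have [A0 [s0 h0]] := IH b.
pose g t := (1 + (2 * t) *: 'X + 'X^2 : {poly R}).
have rec t : (g t ^+ k.+1)`_b = (g t ^+ k)`_b +
    (if (b == 0)%N then 0 else 2 * t * (g t ^+ k)`_b.-1) +
    (if (b < 2)%N then 0 else (g t ^+ k)`_(b - 2)).
  rewrite exprSr {2}/g !mulrDr mulr1 !coefD -scalerAr coefZ coefMX coefMXn.
  by case: ifP => _ //; rewrite mulr0.
case: b => [|[|b]] in s0 h0 rec *.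
- by exists A0; split=> // t; rewrite rec !addr0 h0.
- have [A1 [s1 h1]] := IH 0%N; exists (A0 + 2 *: A1); split.
    rewrite (leq_trans (size_polyD _ _)) // geq_max s0.
    by rewrite (leq_trans (size_scale_leq _ _)).
  move=> t; rewrite rec /= addr0 h0 h1 parity_evalD parity_evalZ /parity_eval /=; ring.
have [A1 [s1 h1]] := IH b.+1; have [A2 [s2 h2]] := IH b.
exists (A0 + 2 *: (if odd b then A1 else 'X * A1) + A2); split.
  rewrite (leq_trans (size_polyD _ _)) // geq_max; apply/andP; split; last first.
    by apply: leq_trans s2 _; rewrite /=; lia.
  rewrite (leq_trans (size_polyD _ _)) // geq_max s0.
  rewrite (leq_trans (size_scale_leq _ _)) //; case: ifP => ob.
    by apply: leq_trans s1 _; rewrite /=; lia.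
  rewrite mulrC (leq_trans (size_polyMleq _ _)) // size_polyX addn2 /=.
  by apply: leq_trans s1 _; move: ob => /=; lia.
move=> t; rewrite rec /= subn2 /= h0 h1 h2 !parity_evalD parity_evalZ /parity_eval /= negbK.
case: (odd b) => /=; rewrite ?hornerM ?hornerX ?expr0 ?expr1; ring.
Qed.

End ParityEval.

(** * Convolution over a design *)

Section Convolution.
Context {R : realType} {n m N : nat} (z : 'I_N -> 'rV[R]_n).
Hypothesis n2 : (2 <= n)%N.
Hypothesis zS : forall j, sphere (z j).
Variable j0 : 'I_N.

Definition avg (F : 'rV[R]_n -> R) : R := N%:R^-1 * \sum_j F (z j).

(** For an antipodal code, written by one point of each pair, this is the design
    property of strength [2 m - 1]. *)
Definition even_design : Prop := forall k, (k < m)%N ->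
  exists c, forall x, sphere x -> avg (fun v => dotv x v ^+ (2 * k)) = c.

Hypothesis dsg : even_design.

Lemma avgE F : avg F = \sum_j N%:R^-1 * F (z j).
Proof. by rewrite /avg big_distrr. Qed.

Lemma eq_avg F G : (forall j, F (z j) = G (z j)) -> avg F = avg G.
Proof. by move=> h; rewrite /avg; congr (_ * _); apply: eq_bigr. Qed.

Lemma avgZ c F : avg (fun v => c * F v) = c * avg F.
Proof. by rewrite /avg mulrCA; congr (_ * _); rewrite big_distrr. Qed.

Lemma avgD F G : avg (fun v => F v + G v) = avg F + avg G.
Proof. by rewrite /avg -mulrDr -big_split. Qed.

Lemma avg_sum (I : finType) (F : I -> 'rV[R]_n -> R) :
  avg (fun v => \sum_i F i v) = \sum_i avg (F i).
Proof. by rewrite /avg exchange_big /= big_distrr. Qed.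

(** Both sides are homogeneous of degree [2 k] in [v]; only [v = 0] is not a
    multiple of a unit vector. *)
Lemma even_design_homogeneous k : (k < m)%N ->
  exists c, forall v, avg (fun u => dotv v u ^+ (2 * k)) = c * dotv v v ^+ k.
Proof.
move=> km; have [c hc] := dsg km; exists c => v.
have [->|v0] := eqVneq v 0.
  have d0 u : dotv 0 u = 0 :> R by rewrite -(scale0r 0) dotvZl mul0r.
  case: k km hc => [|k] _ hc.
    rewrite expr0 mulr1 -(hc (z j0)) //.
  rewrite d0 expr0n mulr0 /avg big1 ?mulr0 // => j _.
  by rewrite d0 expr0n.
have := hc _ (sphere_normalize v0); set s := Num.sqrt _ => E.
have s0 : s != 0.
  rewrite gt_eqF // sqrtr_gt0 lt_def dotv_ge0 andbT.
  by apply: contra v0 => /eqP/dotv_eq0->.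
rewrite -E -(sqr_sqrtr (dotv_ge0 v)) -/s -exprM mulrC -avgZ.
by apply: eq_avg => j; rewrite dotvZl -exprMn mulrA divff ?mul1r.
Qed.

Lemma coef_exp_linear (a b : R) (k i : nat) : (i <= k)%N ->
  ((a%:P + b *: 'X) ^+ k)`_i = a ^+ (k - i) * b ^+ i *+ 'C(k, i).
Proof.
move=> ik; rewrite exprDn coef_sum (bigD1 (Ordinal (ik : (i < k.+1)%N))) //=.
have E j : (a%:P ^+ (k - j) * (b *: 'X) ^+ j *+ 'C(k, j))`_i =
    (a ^+ (k - j) * b ^+ j *+ 'C(k, j)) * (i == j)%:R.
  by rewrite coefMn -polyC_exp exprZn -scalerAr coefZ coefCM coefXn mulrnAl; congr (_ *+ _); ring.
rewrite E eqxx mulr1 big1 ?addr0 // => j jne; rewrite E.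
have /negPf -> : i != j by apply: contra jne => /eqP h; apply/eqP/val_inj.
by rewrite mulr0.
Qed.

(** Polarisation: in [avg ((x + t y) . v)^(2k) = c |x + t y|^(2k)] the
    coefficient of a power of [t] is the average of a monomial on the left, and a
    polynomial in [x . y] on the right since [|x + t y|^2 = 1 + 2 t (x . y) + t^2]. *)
Lemma avg_monomials (e : bool) (i j : nat) : (i + j + e < m)%N ->
  exists s : {poly R}, (size s <= j.+1)%N /\ forall x y, sphere x -> sphere y ->
    avg (fun v => dotv x v ^+ (2 * i + e) * dotv y v ^+ (2 * j + e)) =
    parity_eval e s (dotv x y).
Proof.
move=> ijm; have [c hc] := even_design_homogeneous ijm.
set k := (i + j + e)%N in hc.
have [A [sA hA]] := @gegenbauer_gen_coef R k (2 * j + e).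
have jk : (2 * j + e <= 2 * k)%N by rewrite /k; lia.
have C0 : ('C(2 * k, 2 * j + e)%:R : R) != 0 by rewrite pnatr_eq0 -lt0n bin_gt0.
exists ((c / 'C(2 * k, 2 * j + e)%:R) *: A); split.
  rewrite (leq_trans (size_scale_leq _ _)) //.
  by apply: leq_trans sA _; case: (e); lia.
move=> x y hx hy; rewrite parity_evalZ.
have := hA (dotv x y).
have -> : odd (2 * j + e) = e by rewrite oddD oddM /= oddb.
move=> <-.
have P : \sum_l N%:R^-1 *: ((dotv x (z l))%:P + dotv y (z l) *: 'X) ^+ (2 * k) =
    c *: (1 + (2 * dotv x y) *: 'X + 'X^2) ^+ k.
  apply: (@poly_horner_inj R _ _ (fun _ : R => True)) => [//|t _].
  rewrite horner_sum !(hornerE, horner_exp).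
  have := hc (x + t *: y); rewrite dotvDl !dotvDr !dotvZl !dotvZr.
  move: hx hy; rewrite /sphere /= => -> ->; rewrite (dotvC y x) avgE => H.
  transitivity (c * (1 + t * dotv x y + (t * dotv x y + t * (t * 1))) ^+ k).
    rewrite -H; apply: eq_bigr => l _.
    rewrite !(hornerE, horner_exp) dotvDl dotvZl; congr (_ * (_ + _) ^+ _).
    exact: mulrC.
  by congr (_ * _ ^+ _); ring.
have := congr1 (fun p : {poly R} => p`_(2 * j + e)) P.
rewrite /= coef_sum coefZ => E.
rewrite mulrAC -E avgE big_distrl; apply: eq_bigr => l _.
rewrite coefZ coef_exp_linear // /k.
have -> : (2 * (i + j + e) - (2 * j + e) = 2 * i + e)%N by lia.
by rewrite /= -/k -[X in _ * X / _]mulr_natr [in RHS]mulrA mulfK.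
Qed.

Definition is_conv (e : bool) (q r s : {poly R}) : Prop :=
  forall x y, sphere x -> sphere y ->
    avg (fun v => parity_eval e q (dotv x v) * parity_eval e r (dotv y v)) =
    parity_eval e s (dotv x y).

Lemma is_convC e q r s : is_conv e q r s -> is_conv e r q s.
Proof.
move=> h x y hx hy; rewrite dotvC -h //; apply: eq_avg => j; exact: mulrC.
Qed.

Variables (e : bool) (l : nat).
Hypothesis ml : m = (2 * l + e)%N.

(** The size bounds keep the total degree in [v] at most [2 m - 2], within the
    strength of the design.  The degree of the result is bounded by that of either factor,
    so the polynomials of bounded degree form ideals for the convolution. *)
Lemma exists_conv (q r : {poly R}) : (size q + size r <= 2 * l + 1)%N ->
  exists s : {poly R}, (size s <= size r)%N /\ is_conv e q r s.
Proof.
move=> qr.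
have /choice[S hS] (ij : nat * nat) : exists s : {poly R},
    (ij.1 < size q)%N -> (ij.2 < size r)%N ->
    (size s <= ij.2.+1)%N /\ forall x y, sphere x -> sphere y ->
    avg (fun v => dotv x v ^+ (2 * ij.1 + e) * dotv y v ^+ (2 * ij.2 + e)) =
    parity_eval e s (dotv x y).
  have [iq|] := boolP (ij.1 < size q)%N; last by exists 0.
  have [jr|] := boolP (ij.2 < size r)%N; last by exists 0.
  have [|s hs] := @avg_monomials e ij.1 ij.2; last by exists s.
  by rewrite ml; lia.
exists (\sum_(i < size q) \sum_(j < size r) (q`_i * r`_j) *: S (val i, val j)).
split.
  apply: (big_ind (fun p : {poly R} => (size p <= size r)%N)) => [|p1 p2 h1 h2|i _].
  - by rewrite size_poly0.
  - by rewrite (leq_trans (size_polyD _ _)) // geq_max h1.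
  apply: (big_ind (fun p : {poly R} => (size p <= size r)%N)) => [|p1 p2 h1 h2|j _].
  - by rewrite size_poly0.
  - by rewrite (leq_trans (size_polyD _ _)) // geq_max h1.
  rewrite (leq_trans (size_scale_leq _ _)) //.
  have [sz _] := hS (val i, val j) (ltn_ord i) (ltn_ord j).
  exact: leq_trans sz (ltn_ord j).
move=> x y hx hy.
have e0 t : parity_eval e (0 : {poly R}) t = 0 by rewrite /parity_eval horner0 mulr0.
have esum (I : finType) (F : I -> {poly R}) t :
    parity_eval e (\sum_i F i) t = \sum_i parity_eval e (F i) t.
  by apply: (big_morph (fun p => parity_eval e p t)) => // p1 p2; rewrite parity_evalD.
rewrite esum.
transitivity (avg (fun v => \sum_(i < size q) \sum_(j < size r) (q`_i * r`_j) *
   (dotv x v ^+ (2 * i + e) * dotv y v ^+ (2 * j + e)))).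
  apply: eq_avg => a; rewrite !parity_evalE big_distrlr /=.
  by apply: eq_bigr => i _; apply: eq_bigr => j _; ring.
rewrite avg_sum; apply: eq_bigr => i _; rewrite avg_sum esum.
apply: eq_bigr => j _; rewrite avgZ parity_evalZ.
have [_ ->] := hS (val i, val j) (ltn_ord i) (ltn_ord j) => //.
Qed.

(** The measure on the squares [(z j0 . z j)^2], which represents the weight
    [t^(2 e)] of the parity class. *)
Definition base_weight (j : 'I_N) : R := N%:R^-1 * dotv (z j0) (z j) ^+ (2 * e).
Definition base_node (j : 'I_N) : R := dotv (z j0) (z j) ^+ 2.
Notation quadz := (quad base_weight base_node).

Lemma base_weight_ge0 j : 0 <= base_weight j.
Proof. by rewrite mulr_ge0 ?invr_ge0 ?ler0n // exprM exprn_ge0 // sqr_ge0. Qed.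

Lemma quad_avg q r : quadz (q * r) =
  avg (fun v => parity_eval e q (dotv (z j0) v) * parity_eval e r (dotv (z j0) v)).
Proof.
rewrite avgE; apply: eq_bigr => j _; rewrite /base_weight /base_node /parity_eval hornerM.
by rewrite mul2n -addnn exprD; ring.
Qed.

Lemma quad_conv q r s : is_conv e q r s -> quadz (q * r) = s.[1].
Proof.
move=> h; rewrite quad_avg h //.
by have := zS j0; rewrite /sphere /= => ->; rewrite /parity_eval !expr1n mul1r.
Qed.

(** Convolution by [r] is self-adjoint: exchange the two averages. *)
Lemma quad_conv_adjoint q r s u s' : is_conv e q r s -> is_conv e u r s' ->
  quadz (s * u) = quadz (q * s').
Proof.
move=> h h'; rewrite !quad_avg.
transitivity (avg (fun v => avg (fun w =>
   parity_eval e q (dotv (z j0) w) * parity_eval e r (dotv v w) * parity_eval e u (dotv (z j0) v)))).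
  apply: eq_avg => j; rewrite -h // mulrC -avgZ; apply: eq_avg => i; ring.
transitivity (avg (fun w => avg (fun v =>
   parity_eval e q (dotv (z j0) w) * parity_eval e r (dotv v w) * parity_eval e u (dotv (z j0) v)))).
  rewrite /avg; under eq_bigr do rewrite big_distrr.
  rewrite exchange_big /=; congr (_ * _); apply: eq_bigr => i _.
  by rewrite big_distrr.
apply: eq_avg => j; rewrite -h' // -avgZ; apply: eq_avg => i.
by rewrite (dotvC (z j)); ring.
Qed.

(** If [q * q] has average zero around [z j0], then around every point of the
    sphere by the design property, so [q] vanishes on all dot products with
    [z j0], and these fill [-1, 1]. *)
Lemma quad_base_definite : quad_definite base_weight base_node l.
Proof.
move=> q sq q0; apply: (@parity_eval_eq0 _ e) => t t1.
have [|s [_ hs]] := @exists_conv q q; first by lia.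
have [x [hx <-]] := sphere_dot_surj n2 (zS j0) t1.
have : avg (fun v => parity_eval e q (dotv x v) * parity_eval e q (dotv x v)) = 0.
  rewrite hs //; move: (quad_conv hs); rewrite q0 => s1.
  by move: hx; rewrite /sphere /= => ->; rewrite /parity_eval !expr1n mul1r -s1.
have N0 : (N%:R : R) != 0 by rewrite pnatr_eq0 -lt0n (leq_trans _ (ltn_ord j0)).
move=> /eqP; rewrite mulf_eq0 invr_eq0 (negPf N0) /= psumr_eq0 => [/allP h|j _]; last first.
  by rewrite -expr2 sqr_ge0.
have /h : j0 \in index_enum 'I_N by rewrite mem_index_enum.
by rewrite /= mulf_eq0 orbb => /eqP.
Qed.

(** Half of the Funk-Hecke formula.  The convolution [s] of [Q] and [q] has lower
    degree than [Q], as does the convolution [s'] of [s] and [q]; by adjointness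
    the norm of [s] is the inner product of [Q] and [s'], which is zero. *)
Lemma conv_monic_orth (k : nat) (Q q : {poly R}) :
  (k <= l)%N -> monic_orth base_weight base_node k Q ->
  (size q <= k)%N -> is_conv e Q q 0.
Proof.
move=> kl [mQ sQ oQ] sq.
have [|s [ss hs]] := @exists_conv Q q; first by rewrite sQ; lia.
have [|s' [ss' hs']] := @exists_conv s q; first by lia.
suff s0 : s = 0 by rewrite -s0.
apply: quad_base_definite; first by lia.
by rewrite (quad_conv_adjoint hs hs') oQ //; lia.
Qed.

(** The unit is the reproducing kernel: it represents the evaluation at 1, and
    the value at 1 of a convolution is an inner product. *)
Lemma exists_conv_unit k : (k <= l)%N -> exists K : {poly R}, (size K <= k)%N /\
  forall q : {poly R}, (size q <= k)%N -> is_conv e K q q.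
Proof.
move=> kl.
have df i : (i <= l)%N -> quad_definite base_weight base_node i.
  by move=> il q sq; apply: quad_base_definite; lia.
have [K [sK hK]] := quad_riesz base_weight_ge0 (l := fun p => p.[1])
  (fun p q => hornerD p q 1) (fun c p => hornerZ c p 1) (df _ kl).
exists K; split=> // q sq.
have [|s [ss hs]] := @exists_conv K q; first by lia.
suff s0 : s = q by rewrite -[X in is_conv _ _ _ X]s0.
apply/eqP; rewrite -subr_eq0; apply/eqP; apply: (df k kl).
  by rewrite (leq_trans (size_polyD _ _)) // size_polyN geq_max sq andbT; lia.
have orth (r : {poly R}) : (size r <= k)%N -> quadz ((s - q) * r) = 0.
  move=> sr; have [|s' [ss' hs']] := @exists_conv r q; first by lia.
  rewrite mulrBl quadB (quad_conv_adjoint hs hs') hK ?(leq_trans ss') //.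
  by rewrite -(quad_conv hs') mulrC subrr.
apply: orth.
by rewrite (leq_trans (size_polyD _ _)) // size_polyN geq_max sq andbT; lia.
Qed.

(** Positive definiteness of the Gegenbauer polynomials up to degree [m].  Start
    from a feature map [h] of the monomial kernel [t^(2k+e)] and subtract from
    [h x] its average against the reproducing kernel [K].  The average reproduces
    the part of degree less than [2k+e] and annihilates [Q], so that what is left
    is a feature map of [Q] alone.  This needs averages of degree at most
    [2m - 1] only, even for the Gegenbauer polynomial of degree [m] itself. *)
Lemma posdef_monic_orth k Q : (k <= l)%N ->
  monic_orth base_weight base_node k Q -> posdef_kernel n (parity_eval e Q).
Proof.
move=> kl hQ; have [K [sK hK]] := exists_conv_unit kl.
have [D [h hh]] := @posdef_exp R n (2 * k + e).
have [mQ sQ _] := hQ.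
have sq : (size (Q - 'X^k)%R <= k)%N.
  by rewrite -opprB size_polyN; apply: monic_orth_size_sub hQ.
set q := (Q - 'X^k)%R in sq.
have hh' x y : sphere x -> sphere y ->
    \sum_d h d x * h d y = parity_eval e Q (dotv x y) - parity_eval e q (dotv x y).
  move=> hx hy; rewrite -hh // -parity_evalXn /q /parity_eval hornerD hornerN; ring.
have hKQ := is_convC (conv_monic_orth kl hQ sK).
have e0 t : parity_eval e (0 : {poly R}) t = 0 by rewrite /parity_eval horner0 mulr0.
(* the average against K of the monomial kernel Q - q is 0 - q *)
have C x y : sphere x -> sphere y ->
    avg (fun v => parity_eval e K (dotv x v) * \sum_d h d v * h d y) =
    - parity_eval e q (dotv x y).
  move=> hx hy; rewrite -hK // -[RHS]add0r -[X in X - _](e0 (dotv x y)).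
  rewrite -hKQ // -mulN1r -avgZ -avgD; apply: eq_avg => j.
  by rewrite hh' // (dotvC (z j)); ring.
exists D, (fun d x => h d x - avg (fun v => parity_eval e K (dotv x v) * h d v)).
move=> x y hx hy.
pose a d := h d x; pose b d := h d y.
pose a' d := avg (fun v => parity_eval e K (dotv x v) * h d v).
pose b' d := avg (fun v => parity_eval e K (dotv y v) * h d v).
have Eab : \sum_d a d * b d = parity_eval e Q (dotv x y) - parity_eval e q (dotv x y) by exact: hh'.
have Ea'h w : sphere w -> \sum_d a' d * h d w = - parity_eval e q (dotv x w).
  move=> hw; rewrite -C //.
  under eq_bigr do rewrite mulrC -avgZ.
  rewrite -avg_sum; apply: eq_avg => j; rewrite big_distrr.
  by apply: eq_bigr => d _ /=; ring.
have Eab' : \sum_d a d * b' d = - parity_eval e q (dotv x y).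
  rewrite dotvC -C //.
  under eq_bigr do rewrite -avgZ.
  rewrite -avg_sum; apply: eq_avg => j; rewrite big_distrr.
  by apply: eq_bigr => d _ /=; rewrite /a; ring.
have Ea'b' : \sum_d a' d * b' d = - parity_eval e q (dotv x y).
  under eq_bigr do rewrite -avgZ.
  rewrite -avg_sum -mulN1r [in RHS]dotvC -hK // -avgZ; apply: eq_avg => j.
  transitivity (parity_eval e K (dotv y (z j)) * \sum_d a' d * h d (z j)).
    by rewrite big_distrr; apply: eq_bigr => d _ /=; ring.
  by rewrite Ea'h //; ring.
transitivity (\sum_d (a d * b d - a' d * b d - a d * b' d + a' d * b' d)).
  rewrite !(big_split, sumrN) /= Eab Eab' Ea'b' (Ea'h y hy); ring.
by apply: eq_bigr => d _; rewrite /a /b /a' /b'; ring.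
Qed.

(** The inner products with the orthogonal polynomials are, up to positive
    factors, the coefficients of [p] in the orthogonal basis. *)
Lemma posdef_of_quad_ge0 (k : nat) (p : {poly R}) : (k <= l)%N -> (size p <= k)%N ->
  (forall i Q, (i < k)%N -> monic_orth base_weight base_node i Q -> 0 <= quadz (p * Q)) ->
  posdef_kernel n (parity_eval e p).
Proof.
elim: k p => [|k IH] p kl sp pos.
  have -> : p = 0 by apply/eqP; rewrite -size_poly_eq0 -leqn0.
  apply: posdef_ext (posdef_const (lexx 0)) => t.
  by rewrite /parity_eval horner0 mulr0.
have dk : quad_definite base_weight base_node k.
  by move=> q sq; apply: quad_base_definite; lia.
have [Q hQ] := exists_monic_orth base_weight_ge0 dk; have [mQ sQ oQ] := hQ.
have [c [r [pE sr]]] := monic_split mQ sQ sp.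
have E : quadz (p * Q) = c * quadz (Q * Q).
  by rewrite pE mulrDl quadD -scalerAl quadZ [r * Q]mulrC (oQ r) // addr0.
have Q0 : Q != 0 by rewrite -size_poly_eq0 sQ.
have c0 : 0 <= c.
  have := pos k Q (ltnSn k) hQ; rewrite E pmulr_lge0 //.
  by apply: (quad_sqr_gt0 base_weight_ge0 quad_base_definite); rewrite ?sQ.
have PQ : posdef_kernel n (parity_eval e Q) by apply: posdef_monic_orth hQ; lia.
have Pr : posdef_kernel n (parity_eval e r).
  apply: IH => //; first by lia.
  move=> i Q' ik hQ'; have [mQ' sQ' oQ'] := hQ'.
  have := pos i Q' (ltnW ik) hQ'.
  by rewrite pE mulrDl quadD -scalerAl quadZ oQ ?sQ' // mulr0 add0r.
apply: (@posdef_ext _ _ (fun t => c * parity_eval e Q t + parity_eval e r t)).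
  by move=> t; rewrite pE parity_evalD parity_evalZ.
by apply: posdefD => //; apply: posdefM => //; apply: posdef_const.
Qed.

(** When [size bs = l] the product has degree [l], where the measure is no longer
    known to be definite; the difference with the orthogonal polynomial of the
    same degree falls under the preceding lemma. *)
Lemma posdef_node_prod (bs : seq R) : (size bs <= l)%N -> sorted <%R bs ->
  (forall j, base_weight j != 0 -> base_node j \in bs \/ {in bs, forall b, b <= base_node j}) ->
  posdef_kernel n (parity_eval e (\prod_(b <- bs) ('X - b%:P))).
Proof.
move=> sb srt supp; set F := \prod_(b <- bs) _.
have sF : size F = (size bs).+1 by rewrite size_prod_XsubC.
have mF : F \is monic by exact: monic_prod_XsubC.
have df i : (i <= l)%N -> quad_definite base_weight base_node i.
  by move=> il q sq; apply: quad_base_definite; lia.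
have pos i Q : (i <= l)%N -> monic_orth base_weight base_node i Q -> 0 <= quadz (F * Q).
  by move=> il hQ; apply: (quad_node_prod_ge0 srt base_weight_ge0 supp (df i il) hQ).
have [Q hQ] := exists_monic_orth base_weight_ge0 (df _ sb); have [mQ sQ oQ] := hQ.
have := monic_sub_size mQ sQ (eq_leq sF).
have -> : F`_(size bs) = 1 by move: mF; rewrite monicE lead_coefE sF => /eqP.
rewrite scale1r => sr.
have PQ : posdef_kernel n (parity_eval e Q) by apply: posdef_monic_orth hQ.
have Pr : posdef_kernel n (parity_eval e (F - Q)).
  apply: (@posdef_of_quad_ge0 (size bs) (F - Q)) => // i Q' il hQ'.
  have [_ sQ' _] := hQ'.
  rewrite mulrBl quadB oQ ?sQ' // subr0; apply: (pos i Q' _ hQ'); lia.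
apply: posdef_ext (posdefD PQ Pr) => t.
by rewrite -parity_evalD addrC subrK.
Qed.

End Convolution.

(** * Hermite interpolation with nodes of multiplicity at most two *)

Section Interpolation.
Local Open Scope classical_set_scope.
Local Open Scope ring_scope.
Context {R : realType}.

(** The bound by [last a s] in the conclusion is what places the zeros inside the
    interval spanned by the nodes. *)
Lemma rolle_path (g g' : R -> R) a s : path <%R a s ->
  (forall x y, x \in a :: s -> y \in a :: s -> {within `[x, y], continuous g}) ->
  (forall x y t, x \in a :: s -> y \in a :: s -> x < t < y -> is_derive t 1 g (g' t)) ->
  {in a :: s, forall x, g x = 0} ->
  exists s', [/\ path <%R a s', size s' = size s, {in s', forall x, g' x = 0},
    {in s', forall x, x \notin a :: s} & {in s', forall x, x < last a s}].
Proof.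
elim: s a => [|b s IH] a /=; first by move=> *; exists [::].
move=> /andP[ab pb] cont der z.
have [||| s' [p' sz' z' nin' lst']] := IH b pb.
- by move=> x y hx hy; apply: cont; rewrite inE ?hx ?hy orbT.
- by move=> x y t hx hy; apply: der; rewrite inE ?hx ?hy orbT.
- by move=> x hx; apply: z; rewrite inE hx orbT.
have ha : a \in [:: a, b & s] by rewrite mem_head.
have hb : b \in [:: a, b & s] by rewrite !inE eqxx orbT.
have [c] : exists2 c, c \in `]a, b[%R & is_derive c 1 g 0.
  apply: Rolle => //; last by rewrite !z.
  - move=> x; rewrite in_itv /= => hx.
    by have [] := der a b x ha hb hx.
  - exact: cont.
rewrite in_itv /= => /andP[ac cb] dc.
have bs : {in s, forall x, b < x} by apply/allP; move: pb; rewrite lt_path_sortedE => /andP[].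
have bs' : {in s', forall x, b < x} by apply/allP; move: p'; rewrite lt_path_sortedE => /andP[].
have lastb : b <= last b s.
  by case: s bs {IH pb cont der z sz' nin' lst' ha hb} => //= y s bs; apply/ltW/bs/mem_last.
exists (c :: s'); split=> /=.
- rewrite ac /= lt_path_sortedE; apply/andP; split.
    by apply/allP => x /bs' /(lt_trans cb).
  exact: path_sorted p'.
- by rewrite sz'.
- move=> x; rewrite inE => /predU1P[->|/z' //].
  have [d1 e1] := dc.
  have [|_ e2] := der a b c ha hb; first by rewrite ac.
  by rewrite -e2.
- move=> x; rewrite inE => /predU1P[->|xs'].
    rewrite !inE !negb_or gt_eqF // lt_eqF //=.
    by apply/negP => /bs; rewrite ltNge ltW.
  by rewrite inE negb_or nin' // andbT gt_eqF // (lt_trans ab) // bs'.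
- move=> x; rewrite inE => /predU1P[->|/lst' //].
  exact: lt_le_trans lastb.
Qed.

Lemma rolle_uniq (g g' : R -> R) (s : seq R) : uniq s ->
  (forall x y, x \in s -> y \in s -> {within `[x, y], continuous g}) ->
  (forall x y t, x \in s -> y \in s -> x < t < y -> is_derive t 1 g (g' t)) ->
  {in s, forall x, g x = 0} ->
  exists s', [/\ uniq s', size s' = (size s).-1, {in s', forall x, g' x = 0},
    {in s', forall x, x \notin s} &
    {in s', forall x, exists a b, [/\ a \in s, b \in s & a < x < b]}].
Proof.
move=> us cont der z.
have : sorted <%R (sort <=%R s) by rewrite lt_sorted_uniq_le sort_uniq us sort_le_sorted.
have ms := mem_sort <=%R s; have := size_sort <=%R s.
case: (sort _ _) ms => [|a t] ms sz srt; first by exists [::]; rewrite /= -sz.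
have [||| s' [p' sz' z' nin' lst']] := @rolle_path g g' a t srt.
- by move=> x y; rewrite !ms; apply: cont.
- by move=> x y u; rewrite !ms; apply: der.
- by move=> x; rewrite ms; apply: z.
exists s'; split=> //.
- exact: lt_sorted_uniq (path_sorted p').
- by rewrite sz' -sz.
- by move=> x /nin'; rewrite ms.
move=> x xs'; exists a, (last a t); split; rewrite -?ms ?mem_head ?mem_last //.
rewrite lst' // andbT; move: p'; rewrite lt_path_sortedE => /andP[/allP h _].
exact: h.
Qed.

Lemma rolle_iter (g : nat -> R -> R) (M k : nat) (s : seq R) :
  (forall i (t : R), (k <= i < k + M)%N -> 0 < t < 1 -> is_derive t 1 (g i) (g i.+1 t)) ->
  uniq s -> size s = M.+1 -> {in s, forall x, 0 < x < 1} ->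
  {in s, forall x, g k x = 0} -> exists2 xi, 0 < xi < 1 & g (k + M)%N xi = 0.
Proof.
elim: M k s => [|M IH] k s der us sz rng z.
  case: s sz rng z us => [//|x s] _ rng z _; exists x.
    by apply: rng; rewrite mem_head.
  by rewrite addn0 z // mem_head.
have hk : (k <= k < k + M.+1)%N by rewrite leqnn /= addnS ltnS leq_addr.
have itv x y t : x \in s -> y \in s -> x <= t <= y -> 0 < t < 1.
  move=> /rng/andP[x0 _] /rng/andP[_ y1] /andP[xt ty].
  by rewrite (lt_le_trans x0) // (le_lt_trans ty).
have [|| s' [us' sz' z' _ rng']] := @rolle_uniq (g k) (g k.+1) s us _ _ z.
- move=> x y xs ys; apply: derivable_within_continuous => t.
  rewrite in_itv /= => /(itv _ _ _ xs ys) ht.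
  by have [] := der k t hk ht.
- move=> x y t xs ys /andP[xt ty]; apply: der => //; apply: (itv x y) => //.
  by rewrite !ltW.
have [|||||xi hxi E] := IH k.+1 s'.
- by move=> i t /andP[ki iM]; apply: der; rewrite ltnW //= addnS -addSn.
- by [].
- by rewrite sz' sz.
- move=> x /rng' [a [b [ha hb /andP[ax xb]]]].
  by apply: (itv a b) => //; rewrite !ltW.
- by [].
by exists xi => //; rewrite addnS -addSn.
Qed.

(** Double nodes must be interior, because no derivative is available at the
    endpoints. *)
Definition double_nodes (s : seq R) : Prop := {in s, forall b,
  [/\ 0 <= b <= 1, (count_mem b s <= 2)%N & (1 < count_mem b s)%N -> 0 < b < 1]}.

Lemma size_undup_count (s : seq R) : {in s, forall b, (count_mem b s <= 2)%N} ->
  size s = (size (undup s) + count (fun b => (1 < count_mem b s)%N) (undup s))%N.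
Proof.
move=> h; rewrite -{1}(perm_size (perm_count_undup s)) size_flatten /shape -map_comp.
have : {in undup s, forall b, (0 < count_mem b s <= 2)%N}.
  by move=> b; rewrite mem_undup => bs; rewrite h // andbT -has_count has_pred1.
elim: (undup s) => //= b u IH hb.
rewrite IH; last by move=> x xu; apply: hb; rewrite inE xu orbT.
by rewrite size_nseq; have := hb b (mem_head _ _); case: ltnP => /=; lia.
Qed.

(** The zeros of [g 1] provided by Rolle's theorem lie off the nodes, so they are
    distinct from the double nodes; together they are [M] zeros of [g 1], and
    simple Rolle steps lead from there to [g M]. *)
Lemma rolle_double (g : nat -> R -> R) (M : nat) (s : seq R) :
  {within `[0, 1], continuous (g 0%N)} ->
  (forall i (t : R), (i < M)%N -> 0 < t < 1 -> is_derive t 1 (g i) (g i.+1 t)) ->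
  (0 < M)%N -> size s = M.+1 -> double_nodes s ->
  {in s, forall b, g 0%N b = 0} ->
  {in s, forall b, (1 < count_mem b s)%N -> g 1%N b = 0} ->
  exists2 xi, 0 < xi < 1 & g M xi = 0.
Proof.
move=> cont der M0 sz ds z0 z1.
pose dbl := [seq b <- undup s | (1 < count_mem b s)%N].
have [|||| s' [us' sz' z' nin rng]] := @rolle_uniq (g 0%N) (g 1%N) (undup s).
- exact: undup_uniq.
- move=> x y; rewrite !mem_undup => /ds[/andP[x0 _] _ _] /ds[/andP[_ y1] _ _].
  apply: continuous_subspaceW cont => t /=; rewrite !in_itv /= => /andP[xt ty].
  by rewrite (le_trans x0) // (le_trans ty).
- move=> x y t; rewrite !mem_undup => /ds[/andP[x0 _] _ _] /ds[/andP[_ y1] _ _].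
  move=> /andP[xt ty]; apply: der => //.
  by rewrite (le_lt_trans x0) // (lt_le_trans ty).
- by move=> x; rewrite mem_undup; apply: z0.
have us : uniq (s' ++ dbl).
  rewrite cat_uniq us' filter_uniq ?undup_uniq // andbT.
  apply/hasPn => x; rewrite mem_filter => /andP[_ xs].
  by apply/negP => /nin; rewrite xs.
have szs : size (s' ++ dbl) = M.
  rewrite size_cat sz' size_filter.
  have := size_undup_count (fun b bs => let: And3 _ c _ := ds b bs in c).
  rewrite sz; case: (undup s) sz (mem_undup s) => [|? ?] sz ms /=; last by lia.
  by case: (s) sz ms => [//|b t] _ /(_ b); rewrite mem_head.
case: M M0 der sz szs => [//|M] _ der sz szs.
have [|||xi hxi E] := @rolle_iter g M 1 (s' ++ dbl) _ us szs.
- by move=> i t /andP[_ iM]; apply: der.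
- move=> x; rewrite mem_cat => /orP[/rng[a [b [ha hb /andP[ax xb]]]]|].
    move: ha hb; rewrite !mem_undup => /ds[/andP[a0 _] _ _] /ds[/andP[_ b1] _ _].
    by rewrite (le_lt_trans a0) // (lt_le_trans xb).
  by rewrite mem_filter mem_undup => /andP[c /ds[_ _]]; apply.
- move=> x; rewrite mem_cat => /orP[/z' //|].
  by rewrite mem_filter mem_undup => /andP[c xs]; apply: z1.
by exists xi.
Qed.

Lemma horner_derivn_top (G : {poly R}) (M : nat) (t : R) :
  (size G <= M.+1)%N -> (G^`(M)).[t] = M`!%:R * G`_M.
Proof.
move=> sG; have /size1_polyC -> : (size G^`(M) <= 1)%N.
  apply/leq_sizeP => j j1; rewrite coef_derivn nth_default ?mul0rn //.
  by apply: leq_trans sG _; lia.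
by rewrite hornerC coef_derivn addn0 ffactnn mulr_natl.
Qed.

Section Newton.
Variables (f : R -> R) (m : nat).
Hypothesis fcont : {within `[0, 1], continuous f}.
Hypothesis fder : forall k (t : R), (k < m)%N -> 0 < t < 1 ->
  is_derive t 1 (f^`(k)%classic) (f^`(k.+1)%classic t).

Definition interpolates (s : seq R) (G : {poly R}) : Prop :=
  {in s, forall b, G.[b] = f b /\
    ((1 < count_mem b s)%N -> (G^`()).[b] = f^`(1)%classic b)}.

Definition node_poly (s : seq R) : {poly R} := \prod_(b <- s) ('X - b%:P).

(** The top coefficient of an interpolating polynomial is a divided difference;
    by the mean value theorem it is a derivative at an interior point. *)
Lemma interpolates_top_coef s G M : (0 < M <= m)%N -> size s = M.+1 ->
  double_nodes s -> interpolates s G -> (size G <= M.+1)%N ->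
  exists2 xi, 0 < xi < 1 & f^`(M)%classic xi = M`!%:R * G`_M.
Proof.
move=> /andP[M0 Mm] sz ds ip sG.
have [||||xi hxi E] := @rolle_double (fun k => f^`(k)%classic - horner (G^`(k))) M s _ _ M0 sz ds.
- apply: within_continuousB => //; apply: continuous_subspaceT.
  exact: continuous_horner.
- move=> i t iM ht; have dG : is_derive t 1 (horner G^`(i)) (G^`(i.+1)).[t].
    by rewrite derivnS; apply: is_derive_poly.
  exact: is_deriveB (fder (leq_trans iM Mm) ht) dG.
- by move=> b /ip[Gb _]; rewrite -[LHS]/(f b - G.[b]) Gb subrr.
- by move=> b /ip[_ Gb] /Gb Eb; rewrite -[LHS]/(f^`(1)%classic b - (G^`()).[b]) Eb subrr.
exists xi => //; apply/eqP; rewrite -(horner_derivn_top xi) // -subr_eq0.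
exact/eqP.
Qed.

Lemma node_poly_rem (s : seq R) c : c \in s -> node_poly s = ('X - c%:P) * node_poly (rem c s).
Proof. by move=> cs; rewrite /node_poly (perm_big _ (perm_to_rem cs)) big_cons. Qed.

Lemma node_poly_eq0 (s : seq R) c : ((node_poly s).[c] == 0) = (c \in s).
Proof. by rewrite -root_prod_XsubC rootE. Qed.

Lemma deriv_node_poly_eq0 (s : seq R) c : c \in s ->
  ((node_poly s)^`().[c] == 0) = (1 < count_mem c s)%N.
Proof.
move=> cs; rewrite (node_poly_rem cs) derivM derivXsubC mul1r hornerD hornerM.
rewrite hornerXsubC subrr mul0r addr0 node_poly_eq0.
by rewrite -has_pred1 has_count count_mem_rem eqxx subn1; case: (count_mem c s) => [|[]].
Qed.

(** The new multiple of [node_poly s] adjusts the value at [x] if [x] is a new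
    node, and the derivative at [x] if [x] is doubled; in either case the quantity
    divided by is nonzero. *)
Lemma interpolates_rcons (s : seq R) x H : double_nodes (rcons s x) -> interpolates s H ->
  exists la, interpolates (rcons s x) (H + la *: node_poly s).
Proof.
move=> ds ip; have [xs|xs] := boolP (x \in s); last first.
  exists ((f x - H.[x]) / (node_poly s).[x]) => b.
  rewrite mem_rcons inE -cats1 count_cat => /predU1P[->|bs].
    rewrite hornerD hornerZ divfK ?node_poly_eq0 // addrC subrK; split=> //.
    by rewrite /= eqxx (count_memPn xs).
  have [hb hb'] := ip b bs.
  have Pb : (node_poly s).[b] = 0 by apply/eqP; rewrite node_poly_eq0.
  rewrite hornerD hornerZ Pb mulr0 addr0; split=> //=.
  have /negPf -> : x != b by apply: contra xs => /eqP->.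
  rewrite !addn0 => cb; rewrite derivD derivZ hornerD hornerZ hb' //.
  by have /eqP -> : (node_poly s)^`().[b] == 0; rewrite ?deriv_node_poly_eq0 ?mulr0 ?addr0.
have c1 : count_mem x s = 1%N.
  have [|_ + _] := ds x; first by rewrite mem_rcons mem_head.
  rewrite -cats1 count_cat /= eqxx addn1 ltnS; have : (0 < count_mem x s)%N.
    by rewrite -has_count has_pred1.
  by case: (count_mem x s) => [|[]].
exists ((f^`(1)%classic x - (H^`()).[x]) / ((node_poly s)^`()).[x]) => b.
have Px : (node_poly s)^`().[x] != 0 by rewrite deriv_node_poly_eq0 // c1.
rewrite mem_rcons inE -cats1 count_cat => hb.
have bs : b \in s by case/predU1P: hb => [->|].
have Pb : (node_poly s).[b] = 0 by apply/eqP; rewrite node_poly_eq0.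
have [ib ib'] := ip b bs.
rewrite hornerD hornerZ Pb mulr0 addr0; split=> //=.
rewrite derivD derivZ hornerD hornerZ; have [<- _|xb] := eqVneq x b.
  by rewrite divfK // addrC subrK.
rewrite !addn0 => cb; rewrite ib' //.
by have /eqP -> : (node_poly s)^`().[b] == 0; rewrite ?deriv_node_poly_eq0 ?mulr0 ?addr0.
Qed.

Lemma double_nodes_take s i : double_nodes s -> double_nodes (take i s).
Proof.
move=> ds b bs; have [|r c d] := ds b; first exact: mem_take bs.
have h : (count_mem b (take i s) <= count_mem b s)%N.
  by rewrite -{2}(cat_take_drop i s) count_cat leq_addr.
by split=> // [|h2]; [apply: leq_trans h c | apply: d; apply: leq_trans h].
Qed.

Lemma size_node_poly s : size (node_poly s) = (size s).+1.
Proof. by rewrite /node_poly size_prod_XsubC. Qed.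

Lemma size_newton_sum s (la : nat -> R) i :
  (size (\sum_(k < i) la k *: node_poly (take k s))%R <= i)%N.
Proof.
apply: (big_ind (fun p : {poly R} => (size p <= i)%N)) => [|p1 p2 h1 h2|k _].
- by rewrite size_poly0.
- by rewrite (leq_trans (size_polyD _ _)) // geq_max h1.
rewrite (leq_trans (size_scale_leq _ _)) // size_node_poly size_take_min.
by have := ltn_ord k; lia.
Qed.

Lemma node_poly_top s : (node_poly s)`_(size s) = 1.
Proof.
have : node_poly s \is monic by exact: monic_prod_XsubC.
by rewrite monicE lead_coefE size_node_poly => /eqP.
Qed.

Lemma newton_expansion s i : double_nodes s -> size s = m -> (i <= m)%N ->
  exists la : nat -> R,
    interpolates (take i s) (\sum_(k < i) la k *: node_poly (take k s)) /\
    forall k, (0 < k < i)%N -> exists2 xi, 0 < xi < 1 & f^`(k)%classic xi = k`!%:R * la k.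
Proof.
move=> ds sz; elim: i => [|i IH] im.
  by exists (fun=> 0); split=> [b|k]; rewrite ?take0 ?ltn0 ?andbF.
have [la [ip hla]] := IH (ltnW im).
have ti : take i.+1 s = rcons (take i s) (nth 0 s i) by rewrite (take_nth 0) ?sz.
have dsi : double_nodes (rcons (take i s) (nth 0 s i)).
  by rewrite -ti; apply: double_nodes_take.
have [c ipc] := interpolates_rcons dsi ip.
pose la' k := if k == i then c else la k.
have sumE : \sum_(k < i.+1) la' k *: node_poly (take k s) =
   \sum_(k < i) la k *: node_poly (take k s) + c *: node_poly (take i s).
  rewrite big_ord_recr /= {2}/la' eqxx; congr (_ + _); apply: eq_bigr => k _.
  by rewrite /la' ltn_eqF.
exists la'; split; first by rewrite ti sumE.
move=> k /andP[k0]; rewrite ltnS leq_eqVlt => /predU1P[ki|ki]; last first.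
  by rewrite /la' ltn_eqF //; apply: hla; rewrite k0.
have szi : size (take i s) = i by rewrite size_takel // sz ltnW.
rewrite ki in k0 *; rewrite /la' eqxx.
have [|||xi hxi E] := @interpolates_top_coef _ _ i _ _ dsi ipc.
- by rewrite k0 ltnW.
- by rewrite size_rcons szi.
- rewrite (leq_trans (size_polyD _ _)) // geq_max (leqW (size_newton_sum _ _ _)) /=.
  by rewrite (leq_trans (size_scale_leq _ _)) // size_node_poly szi.
exists xi => //; rewrite E coefD coefZ nth_default ?size_newton_sum // add0r.
by have := node_poly_top (take i s); rewrite szi => ->; rewrite mulr1.
Qed.

Lemma newton_remainder s H x : double_nodes s -> size s = m -> (0 < m)%N ->
  interpolates s H -> (size H <= m)%N -> 0 <= x <= 1 -> x \notin s ->
  exists2 xi, 0 < xi < 1 &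
    f x - H.[x] = f^`(m)%classic xi / m`!%:R * (node_poly s).[x].
Proof.
move=> ds sz m0 ip sH x01 xs.
have dsx : double_nodes (rcons s x).
  move=> b; rewrite mem_rcons inE -cats1 count_cat => /predU1P[->|bs].
    have : count_mem x s = 0%N by apply/count_memPn.
    by rewrite /= eqxx => ->; split.
  have [r c d] := ds b bs.
  have /negPf /= -> : x != b by apply: contra xs => /eqP->.
  by rewrite !addn0; split.
have [c ipc] := interpolates_rcons dsx ip.
have [|||xi hxi E] := @interpolates_top_coef _ _ m _ _ dsx ipc.
- by rewrite m0 leqnn.
- by rewrite size_rcons sz.
- rewrite (leq_trans (size_polyD _ _)) // geq_max (leqW sH) /=.
  by rewrite (leq_trans (size_scale_leq _ _)) // size_node_poly sz.
exists xi => //; rewrite E coefD coefZ nth_default // add0r.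
have := node_poly_top s; rewrite sz => ->; rewrite mulr1.
have [|<- _] := ipc x; first by rewrite mem_rcons mem_head.
rewrite hornerD hornerZ addrAC subrr add0r [m`!%:R * c]mulrC mulfK //.
Qed.

End Newton.
End Interpolation.

(** * Squares of the dot products as interpolation nodes *)

Section Squares.
Context {R : realType}.
Implicit Types A B : seq R.

Definition squares A : seq R := [seq a ^+ 2 | a <- A & 0 < a].

Definition doubled B : seq R := flatten [seq [:: b; b] | b <- B].

(** The squares of the elements of [A]: the positive ones are interior to [0, 1]
    and are doubled, while 0 is an endpoint and is a simple node.  In total there
    are as many nodes as elements of [A]. *)
Definition hermite_nodes A : seq R := nseq (0 \in A) 0 ++ doubled (squares A).

Lemma mem_doubled B b : (b \in doubled B) = (b \in B).
Proof.
apply/flatten_mapP/idP => [[c cB]|bB]; first by rewrite !inE orbb => /eqP->.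
by exists b => //; rewrite !inE eqxx.
Qed.

Lemma size_doubled B : size (doubled B) = (2 * size B)%N.
Proof. by elim: B => //= b B; rewrite /doubled /= => ->; rewrite mulnS. Qed.

Lemma count_mem_doubled B b : count_mem b (doubled B) = (2 * count_mem b B)%N.
Proof. by elim: B => //= c B; rewrite /doubled /= => ->; lia. Qed.

(** Newton's partial products factor into two products over initial segments of
    simple nodes; positive definiteness is available for the factors. *)
Lemma node_poly_take_doubled B k : node_poly (take k (doubled B)) =
  node_poly (take k./2 B) * node_poly (take (uphalf k) B).
Proof.
have np b s : node_poly (b :: s) = ('X - b%:P) * node_poly s.
  by rewrite /node_poly big_cons.
have n0 : node_poly ([::] : seq R) = 1 by rewrite /node_poly big_nil.
elim: B k => [|b B IH] k; first by rewrite n0 mulr1.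
case: k => [|[|k]]; rewrite /= ?take0 ?n0 ?mulr1 ?mul1r //.
by rewrite !np -/(doubled B) IH; ring.
Qed.

Lemma squares_sorted A : sorted <%R A -> sorted <%R (squares A).
Proof.
move=> srt; have : sorted <%R [seq a <- A | 0 < a].
  by apply: sorted_filter srt; apply: lt_trans.
rewrite /squares sorted_map; apply: sub_in_sorted (fun a => 0 < a) _ _ _ _ _.
  move=> a b /= a0 b0 ab; rewrite /relpre /= !expr2.
  by apply: ltr_pM => //; apply: ltW.
by apply/allP => a; rewrite mem_filter => /andP[].
Qed.

Lemma size_squares A : uniq A -> {in A, forall a, - a \in A} ->
  size A = (2 * size (squares A) + (0%R \in A))%N.
Proof.
move=> uA sA; rewrite size_map size_filter.
have E : count (fun a => 0 < a) A = count (fun a => a < 0) A.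
  rewrite -!size_filter -(size_map (@GRing.opp R)).
  apply/perm_size/uniq_perm; rewrite ?(map_inj_uniq oppr_inj) ?filter_uniq //.
  move=> a; rewrite mem_filter; apply/mapP/andP => [[b]|[a0 aA]].
    by rewrite mem_filter => /andP[b0 bA] ->; rewrite oppr_lt0 b0 sA.
  by exists (- a); rewrite ?opprK // mem_filter oppr_gt0 a0 sA.
rewrite -(count_uniq_mem _ uA) mul2n -addnn {1}E.
rewrite -(count_predC (fun a => a < 0) A) -addnA; congr (_ + _)%N.
rewrite -(count_predUI (fun a => 0 < a)) [X in (_ + X)%N](_ : _ = 0%N) ?addn0.
  by apply: eq_count => a /=; rewrite -leNgt le_eqVlt eq_sym orbC.
apply/eqP; rewrite eqn0Ngt -has_count; apply/hasPn => a _ /=.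
by case: eqVneq => [->|]; rewrite ?ltxx ?andbF.
Qed.

Lemma mem_hermite_nodes A t : {in A, forall a, - a \in A} ->
  (t ^+ 2 \in hermite_nodes A) = (t \in A).
Proof.
move=> sA; rewrite mem_cat mem_nseq mem_doubled.
apply/orP/idP => [[/andP[e0 /eqP t0]|/mapP[a]]|tA].
- have -> : t = 0 by apply/eqP; rewrite -sqrf_eq0 t0.
  by case: (0 \in A) e0.
- rewrite mem_filter => /andP[_ aA] /eqP; rewrite eqf_sqr => /orP[]/eqP -> //.
  exact: sA.
have [t0|t0|t0] := ltgtP t 0.
- right; apply/mapP; exists (- t); last by rewrite sqrrN.
  by rewrite mem_filter oppr_gt0 t0 sA.
- by right; apply/mapP; exists t => //; rewrite mem_filter t0.
- by left; move: tA; rewrite t0 expr0n /= => ->; rewrite eqxx.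
Qed.

Lemma squares_range A : {in A, forall a, -1 < a < 1} ->
  {in squares A, forall b, 0 < b < 1}.
Proof.
move=> rA b /mapP[a]; rewrite mem_filter => /andP[a0 /rA/andP[_ a1]] ->.
by rewrite exprn_gt0 //= expr_lt1 // ltW.
Qed.

Lemma hermite_nodes_double A : sorted <%R A -> {in A, forall a, -1 < a < 1} ->
  double_nodes (hermite_nodes A).
Proof.
move=> srt rA; have u : uniq (squares A) by exact/lt_sorted_uniq/squares_sorted.
have z0 : 0 \notin squares A by apply/negP => /(squares_range rA); rewrite ltxx.
move=> b; rewrite /hermite_nodes count_cat count_nseq count_mem_doubled.
rewrite (count_uniq_mem _ u) mem_cat mem_nseq mem_doubled.
case: (boolP (b \in squares A)) => [bs _|bs].
  have /andP[b0 b1] := squares_range rA bs.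
  rewrite !ltW //= eq_sym (gt_eqF b0) b0 b1 mul0n; split=> //.
rewrite orbF => /andP[_ /eqP ->]; rewrite lexx ler01 /= eqxx.
by case: (0 \in A); split.
Qed.

Lemma node_poly_hermite_gt0 A x : 0 <= x -> x \notin hermite_nodes A ->
  0 < (node_poly (hermite_nodes A)).[x].
Proof.
rewrite mem_cat mem_nseq negb_or mem_doubled => x0 /andP[xe xs].
rewrite /node_poly /hermite_nodes big_cat hornerM /=.
have -> : \prod_(b <- doubled (squares A)) ('X - b%:P) =
    node_poly (squares A) * node_poly (squares A).
  have := node_poly_take_doubled (squares A) (2 * size (squares A)).
  rewrite -/(node_poly (doubled (squares A))) -{1}size_doubled take_size => ->.
  rewrite mul2n.
  by rewrite uphalf_double doubleK take_size.
rewrite hornerM -expr2 pmulr_lgt0; last first.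
  by rewrite lt_def sqr_ge0 sqrf_eq0 node_poly_eq0 xs.
case: (0 \in A) xe => /= xe; last by rewrite big_nil hornerC ltr01.
by rewrite big_cons big_nil mulr1 hornerXsubC subr0 lt_def xe.
Qed.

End Squares.

(** * Energy against a design *)

Definition pair_sum (R : realType) (n N : nat) (W : 'I_N -> R)
    (x : 'I_N -> 'rV[R]_n) (h : R -> R) : R :=
  \sum_i \sum_j W i * W j * h (dotv (x i) (x j)).

Section PairSum.
Context {R : realType} {n N : nat} (W : 'I_N -> R) (x : 'I_N -> 'rV[R]_n).
Notation Q := (pair_sum W x).

Lemma pair_sumD h1 h2 : Q (fun t => h1 t + h2 t) = Q h1 + Q h2.
Proof.
rewrite -big_split; apply: eq_bigr => i _; rewrite -big_split.
by apply: eq_bigr => j _; rewrite mulrDr.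
Qed.

Lemma pair_sumZ c h : Q (fun t => c * h t) = c * Q h.
Proof.
rewrite /pair_sum big_distrr; apply: eq_bigr => i _; rewrite big_distrr.
by apply: eq_bigr => j _; rewrite mulrCA.
Qed.

Lemma eq_pair_sum h1 h2 : h1 =1 h2 -> Q h1 = Q h2.
Proof. by move=> h; apply: eq_bigr => i _; apply: eq_bigr => j _; rewrite h. Qed.

Lemma pair_sum_sum (I : finType) (h : I -> R -> R) :
  Q (fun t => \sum_k h k t) = \sum_k Q (h k).
Proof.
rewrite /pair_sum [RHS]exchange_big; apply: eq_bigr => i _; rewrite [RHS]exchange_big.
by apply: eq_bigr => j _; rewrite big_distrr.
Qed.

End PairSum.

Section Gap.
Context {R : realType} {n N : nat} (W : 'I_N -> R) (x z : 'I_N -> 'rV[R]_n).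
Hypothesis xS : forall i, sphere (x i).
Hypothesis zS : forall i, sphere (z i).
Hypothesis N0 : (0 < N)%N.
Hypothesis W1 : \sum_i W i = 1.
Let uni := (fun _ : 'I_N => N%:R^-1 : R).

(** The averages of [h] around the points [z j] are all equal to [c], so that both
    the mixed sum and the energy of [z] equal [c]; the difference of energies is
    then the energy of the difference of the two measures, a sum of squares. *)
Lemma pair_sum_gap (h : R -> R) c (D : finType) (g : D -> 'rV[R]_n -> R) :
  (forall u v, sphere u -> sphere v -> h (dotv u v) = \sum_d g d u * g d v) ->
  (forall u, sphere u -> avg z (fun v => h (dotv u v)) = c) ->
  pair_sum W x h - pair_sum uni z h =
  \sum_d (\sum_i W i * g d (x i) - avg z (g d)) ^+ 2.
Proof.
move=> hg hc; pose a d := \sum_i W i * g d (x i); pose b d := avg z (g d).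
have Eaa : \sum_d a d * a d = pair_sum W x h.
  under eq_bigr do rewrite big_distrlr /=.
  rewrite exchange_big; apply: eq_bigr => i _; rewrite exchange_big.
  apply: eq_bigr => j _; rewrite hg // big_distrr.
  by apply: eq_bigr => d _ /=; ring.
have Ebg u : sphere u -> \sum_d g d u * b d = c.
  move=> hu; rewrite -(hc u hu); under eq_bigr do rewrite -avgZ.
  by rewrite -avg_sum; apply: eq_avg => j; rewrite hg.
have Eab : \sum_d a d * b d = c.
  under eq_bigr do rewrite big_distrl.
  rewrite exchange_big /= -[RHS]mul1r -W1 big_distrl; apply: eq_bigr => i _.
  rewrite -(Ebg (x i)) // big_distrr; apply: eq_bigr => d _ /=; ring.
have avgc : avg z (fun=> c) = c.
  by rewrite /avg sumr_const card_ord -[c *+ N]mulr_natl mulKf ?pnatr_eq0 -?lt0n.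
have Ebb : \sum_d b d * b d = c.
  rewrite -[RHS]avgc; under eq_bigr do rewrite -avgZ.
  rewrite -avg_sum; apply: eq_avg => j; rewrite -(Ebg (z j)) //.
  by apply: eq_bigr => d _; rewrite mulrC.
have Ez : pair_sum uni z h = c.
  rewrite -[RHS]avgc avgE; apply: eq_bigr => i _; rewrite -(hc (z i)) // avgE big_distrr.
  by apply: eq_bigr => j _; rewrite /uni /=; ring.
transitivity (\sum_d (a d * a d - 2 * (a d * b d) + b d * b d)).
  by rewrite !(big_split, sumrN) /= -big_distrr /= Eaa Eab Ebb Ez; ring.
by apply: eq_bigr => d _; rewrite -/(a d) -/(b d); ring.
Qed.

End Gap.

(** * The bound for projective codes *)

Section Core.
Context {R : realType} {n m N : nat} (A : seq R) (z : 'I_N -> 'rV[R]_n).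
Hypothesis n2 : (2 <= n)%N.
Hypothesis m0 : (0 < m)%N.
Hypothesis N0 : (0 < N)%N.
Hypothesis A_sorted : sorted <%R A.
Hypothesis A_range : {in A, forall a, -1 < a < 1}.
Hypothesis A_sym : {in A, forall a, - a \in A}.
Hypothesis A_size : size A = m.
Hypothesis zS : forall j, sphere (z j).
Hypothesis z_design : even_design (m := m) z.
Hypothesis z_dots : forall i j, i != j -> dotv (z i) (z j) \in A.

Let e : bool := 0 \in A.
Let ns : seq R := hermite_nodes A.
Let uni := (fun _ : 'I_N => N%:R^-1 : R).

Lemma size_hermite_nodes : size ns = m.
Proof.
rewrite size_cat size_nseq size_doubled addnC -A_size -size_squares //.
exact: lt_sorted_uniq.
Qed.

(** The square [(z j0 . z j)^2] is 1 if [j = j0]; otherwise it is a square of a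
    nonzero element of [A], hence a node, or it is 0 and then [e] holds and its
    weight vanishes. *)
Lemma posdef_squares_prod k :
  posdef_kernel n (parity_eval e (node_poly (take k (squares A)))).
Proof.
have ml : m = (2 * size (squares A) + e)%N.
  by rewrite -A_size -size_squares //; apply: lt_sorted_uniq.
apply: (posdef_node_prod n2 zS (j0 := Ordinal N0) z_design ml).
- by rewrite size_take_min geq_minr.
- exact/take_sorted/squares_sorted.
have srt := squares_sorted A_sorted.
have le1 : {in take k (squares A), forall b, b <= 1}.
  by move=> b /mem_take /(squares_range A_range) /andP[_ /ltW].
move=> j; rewrite /base_weight /base_node.
have [<-|j0] := eqVneq (Ordinal N0) j.
  by have := zS (Ordinal N0); rewrite /sphere /= => ->; rewrite !expr1n; right.
have tA := z_dots j0; set t := dotv _ _ in tA * => w0.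
have t0 : t != 0.
  apply: contra w0 => /eqP t0; move: tA; rewrite t0 -/e => ->.
  by rewrite expr0n /= mulr0.
have : t ^+ 2 \in squares A.
  have [lt|gt|] := ltgtP t 0; last by move/eqP; rewrite (negPf t0).
    apply/mapP; exists (- t); last by rewrite sqrrN.
    by rewrite mem_filter oppr_gt0 lt A_sym.
  by apply/mapP; exists t => //; rewrite mem_filter gt.
rewrite -{1}(cat_take_drop k (squares A)) mem_cat => /orP[|hd]; first by left.
right=> b hb; move: srt; rewrite (sorted_pairwise lt_trans).
rewrite -{1}(cat_take_drop k (squares A)) pairwise_cat => /and3P[/allrelP h _ _].
exact/ltW/h.
Qed.

Lemma posdef_newton_nodes k :
  posdef_kernel n (fun t => (node_poly (take k ns)).[t ^+ 2]).
Proof.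
have pd0 : posdef_kernel n (fun t : R => (node_poly ([::] : seq R)).[t ^+ 2]).
  apply: posdef_ext (posdef_const ler01) => t.
  by rewrite /node_poly big_nil hornerC.
have H i := posdefM (posdef_squares_prod i./2) (posdef_squares_prod (uphalf i)).
rewrite /ns /hermite_nodes; case: (boolP (0 \in A)) => [eA|eA] /=.
  case: k => [//|k]; apply: posdef_ext (H k) => t.
  rewrite /parity_eval /e eA expr1 /node_poly /= big_cons -!/(node_poly _).
  rewrite node_poly_take_doubled !hornerM hornerXsubC; ring.
apply: posdef_ext (H k) => t.
by rewrite /parity_eval /e (negPf eA) !expr0 !mul1r node_poly_take_doubled hornerM.
Qed.

Lemma even_design_poly (p : {poly R}) : (size p <= m)%N ->
  exists c, forall x, sphere x -> avg z (fun v => p.[dotv x v ^+ 2]) = c.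
Proof.
move=> sp; have /choice[c hc] (k : nat) : exists c, (k < m)%N ->
    forall x, sphere x -> avg z (fun v => dotv x v ^+ (2 * k)) = c.
  have [km|] := boolP (k < m)%N; last by exists 0.
  by have [c hc] := z_design km; exists c.
exists (\sum_(k < size p) p`_k * c k) => x hx.
transitivity (avg z (fun v => \sum_(k < size p) p`_k * dotv x v ^+ (2 * k))).
  by apply: eq_avg => j; rewrite horner_coef; apply: eq_bigr => k _; rewrite -exprM.
rewrite avg_sum; apply: eq_bigr => k _; rewrite avgZ (hc k) //.
exact: leq_trans (ltn_ord k) sp.
Qed.

Variables (f : R -> R).
Hypothesis fcont : {within `[0, 1], continuous f}%classic.
Hypothesis fder : forall k (t : R), (k < m)%N -> 0 < t < 1 ->
  is_derive t 1 (f^`(k)%classic) (f^`(k.+1)%classic t).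
Hypothesis f_ge0 : forall k (t : R), (0 < k <= m)%N -> 0 < t < 1 ->
  0 <= f^`(k)%classic t.

Variables (W : 'I_N -> R) (x : 'I_N -> 'rV[R]_n).
Hypothesis xS : forall i, sphere (x i).
Hypothesis x_dots : forall i j, i != j -> -1 < dotv (x i) (x j) < 1.
Hypothesis W0 : forall i, 0 < W i.
Hypothesis W1 : \sum_i W i = 1.

Let E := pair_sum W x (fun t => f (t ^+ 2)).
Let E' := pair_sum uni z (fun t => f (t ^+ 2)).
Let gap (h : R -> R) := pair_sum W x h - pair_sum uni z h.

Lemma gap_node_ge0 k : (k < m)%N ->
  0 <= gap (fun t => (node_poly (take k ns)).[t ^+ 2]).
Proof.
move=> km; have [D [g hg]] := posdef_newton_nodes k.
have [|c hc] := @even_design_poly (node_poly (take k ns)).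
  by rewrite size_node_poly size_take_min size_hermite_nodes; lia.
rewrite /gap (pair_sum_gap xS zS N0 W1 hg hc).
by apply: sumr_ge0 => d _; rewrite sqr_ge0.
Qed.

Lemma gapD h1 h2 : gap (fun t => h1 t + h2 t) = gap h1 + gap h2.
Proof. by rewrite /gap !pair_sumD; ring. Qed.

Lemma gapZ c h : gap (fun t => c * h t) = c * gap h.
Proof. by rewrite /gap !pair_sumZ; ring. Qed.

Lemma eq_gap h1 h2 : h1 =1 h2 -> gap h1 = gap h2.
Proof. by move=> h; rewrite /gap !(eq_pair_sum _ _ h). Qed.

Lemma gap_const c : gap (fun=> c) = 0.
Proof.
have S (V : 'I_N -> R) y : \sum_i V i = 1 -> pair_sum V y (fun=> c) = c.
  move=> V1; rewrite -[RHS]mul1r -V1 big_distrl; apply: eq_bigr => i _ /=.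
  by rewrite -big_distrl /= -big_distrr /= V1 mulr1.
rewrite /gap !S ?subrr // sumr_const card_ord -[_ *+ N]mulr_natl mulfV //.
by rewrite pnatr_eq0 -lt0n.
Qed.

(** The three sources of slack in the energy inequality: [la k] are the Newton
    coefficients of the interpolant [H] and [sl] is [f - H].  The first sum is the
    difference of the energies of [H]; the second one comes from the off-diagonal
    terms, which have no counterpart for [z] because its dot products are nodes;
    the last one comes from the diagonal, where the sum of the squared weights
    exceeds that of the uniform weights by their squared distance. *)
Lemma energy_decomposition : exists (la : nat -> R) (sl : R -> R),
  [/\ E - E' = \sum_(k < m) la k * gap (fun t => (node_poly (take k ns)).[t ^+ 2]) +
        (\sum_i \sum_(j | j != i) W i * W j * sl (dotv (x i) (x j) ^+ 2) +
         sl 1 * \sum_i (W i - N%:R^-1) ^+ 2),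
    forall k, (0 < k < m)%N -> exists2 xi, 0 < xi < 1 & la k = f^`(k)%classic xi / k`!%:R
  & forall s, 0 <= s <= 1 -> s \notin ns -> exists2 xi, 0 < xi < 1 &
      exists2 c, 0 < c & sl s = c * f^`(m)%classic xi] /\
   {in ns, forall s, sl s = 0}.
Proof.
have dn : double_nodes ns by exact: hermite_nodes_double.
have [la [ip hla]] := newton_expansion fcont fder dn size_hermite_nodes (leqnn m).
rewrite -{1}size_hermite_nodes take_size in ip.
set H : {poly R} := \sum_(k < m) _ in ip.
have sH : (size H <= m)%N by exact: size_newton_sum ns la m.
exists la, (fun s => f s - H.[s]); split; last first.
  by move=> s /ip[-> _]; rewrite subrr.
split.
- have EH : gap (fun t => H.[t ^+ 2]) =
      \sum_(k < m) la k * gap (fun t => (node_poly (take k ns)).[t ^+ 2]).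
    rewrite /gap.
    have S (V : 'I_N -> R) (y : 'I_N -> 'rV[R]_n) : pair_sum V y (fun t => H.[t ^+ 2]) =
       \sum_(k < m) la k * pair_sum V y (fun t => (node_poly (take k ns)).[t ^+ 2]).
      rewrite -(eq_bigr _ (fun k _ => pair_sumZ _ _ _ _)) -pair_sum_sum.
      by apply: eq_pair_sum => t; rewrite horner_sum; apply: eq_bigr => k _; rewrite hornerZ.
    by rewrite !S -sumrB; apply: eq_bigr => k _; rewrite mulrBr.
  have split_diag (V : 'I_N -> R) (y : 'I_N -> 'rV[R]_n) : (forall i, sphere (y i)) ->
      pair_sum V y (fun t => f (t ^+ 2)) - pair_sum V y (fun t => H.[t ^+ 2]) =
      \sum_i \sum_(j | j != i) V i * V j * (f (dotv (y i) (y j) ^+ 2) - H.[dotv (y i) (y j) ^+ 2])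
      + (f 1 - H.[1]) * \sum_i V i ^+ 2.
    move=> yS; rewrite big_distrr -sumrB -big_split; apply: eq_bigr => i _ /=.
    rewrite -sumrB (bigD1 i) //= addrC; congr (_ + _).
      by apply: eq_bigr => j _; rewrite mulrBr.
    by have := yS i; rewrite /sphere /= => ->; rewrite expr1n; ring.
  have Dx := split_diag W x xS; have Dz := split_diag uni z zS.
  rewrite big1 ?add0r in Dz; last first.
    move=> i _; apply: big1 => j ji; have [|-> _] := ip (dotv (z i) (z j) ^+ 2).
      by rewrite /ns mem_hermite_nodes // z_dots // eq_sym.
    by rewrite subrr mulr0.
  have Nn : (N%:R : R) != 0 by rewrite pnatr_eq0 -lt0n.
  have uni2 : \sum_i uni i ^+ 2 = N%:R^-1.
    by rewrite /uni sumr_const card_ord -[_ *+ N]mulr_natl expr2 mulrA mulfV // mul1r.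
  have var : \sum_i (W i - N%:R^-1) ^+ 2 = \sum_i W i ^+ 2 - N%:R^-1.
    transitivity (\sum_i (W i ^+ 2 - 2 * N%:R^-1 * W i + uni i ^+ 2)).
      by apply: eq_bigr => i _; rewrite /uni; ring.
    by rewrite !(big_split, sumrN) /= -big_distrr /= W1 uni2; ring.
  rewrite -EH var /gap; rewrite uni2 in Dz.
  move: Dx Dz; rewrite -/E -/E'.
  move: (pair_sum W x _) (pair_sum uni z _) (\sum_i \sum_(j | _) _) (f 1 - H.[1]).
  move=> a b c d; move: (\sum_i _) => w h1 h2.
  rewrite mulrBr -h2; have -> : d * w = E - a - c by rewrite h1; ring.
  by ring.
- move=> k hk; have [xi hxi E1] := hla k hk; exists xi => //.
  by rewrite E1 mulrC mulKf // pnatr_eq0 -lt0n fact_gt0.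
move=> s hs sns.
have [xi hxi ->] := newton_remainder fcont fder dn size_hermite_nodes m0 ip sH hs sns.
exists xi => //; exists ((node_poly ns).[s] / m`!%:R); last by ring.
rewrite divr_gt0 ?ltr0n ?fact_gt0 // node_poly_hermite_gt0 //.
by case/andP: hs.
Qed.

Lemma one_notin_nodes : 1 \notin ns.
Proof.
rewrite -(expr1n R 2) /ns mem_hermite_nodes //.
by apply/negP => /A_range; rewrite ltxx andbF.
Qed.

Lemma x_dots_sqr i j : i != j -> 0 <= dotv (x i) (x j) ^+ 2 <= 1.
Proof.
move=> /x_dots /andP[a b]; rewrite sqr_ge0 /=.
by rewrite expr2; nra.
Qed.

Lemma energy_ge : E' <= E.
Proof.
have [la [sl [[D hla hsl] sl0]]] := energy_decomposition.
have sl_ge0 s : 0 <= s <= 1 -> 0 <= sl s.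
  move=> hs; have [/sl0->//|sn] := boolP (s \in ns).
  have [xi hxi [c c0 ->]] := hsl s hs sn.
  by rewrite mulr_ge0 ?(ltW c0) // f_ge0 // m0 leqnn.
rewrite -subr_ge0 D; apply: addr_ge0; last apply: addr_ge0.
- apply: sumr_ge0 => k _; have [k0|k0] := posnP k.
    rewrite k0 take0 (@eq_gap _ (fun=> 1)) ?gap_const ?mulr0 // => t.
    by rewrite /node_poly big_nil hornerC.
  rewrite mulr_ge0 ?gap_node_ge0 //.
  have [|xi hxi ->] := hla k; first by rewrite k0 ltn_ord.
  by rewrite divr_ge0 ?ler0n // f_ge0 // k0 ltnW.
- apply: sumr_ge0 => i _; apply: sumr_ge0 => j ji.
  by rewrite mulr_ge0 ?sl_ge0 ?x_dots_sqr 1?eq_sym // mulr_ge0 // ltW.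
rewrite mulr_ge0 ?sl_ge0 ?ler01 ?lexx //.
by apply: sumr_ge0 => i _; rewrite sqr_ge0.
Qed.

(** The partial products span the polynomials of degree less than [m], so all
    these have zero gap; for an even power the gap is a sum of squares of
    differences of features, which therefore vanish. *)
Lemma even_design_of_gap_eq0 :
  (forall k, (0 < k < m)%N -> gap (fun t => (node_poly (take k ns)).[t ^+ 2]) = 0) ->
  forall k, (k < m)%N -> exists c, forall u, sphere u ->
    \sum_i W i * dotv u (x i) ^+ (2 * k) = c.
Proof.
move=> g0; have gp (p : {poly R}) j : (j <= m)%N -> (size p <= j)%N ->
    gap (fun t => p.[t ^+ 2]) = 0.
  elim: j p => [|j IH] p jm sp.
    rewrite (@eq_gap _ (fun=> 0)) ?gap_const // => t.
    have -> : p = 0 by apply/eqP; rewrite -size_poly_eq0 -leqn0.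
    by rewrite horner0.
  have szj : size (node_poly (take j ns)) = j.+1.
    by rewrite size_node_poly size_takel // size_hermite_nodes ltnW.
  have mj : node_poly (take j ns) \is monic by exact: monic_prod_XsubC.
  have [c [r [-> sr]]] := monic_split mj szj sp.
  rewrite (@eq_gap _ (fun t => c * (node_poly (take j ns)).[t ^+ 2] + r.[t ^+ 2])).
    rewrite gapD gapZ (IH r (ltnW jm) sr) addr0.
    have [j0|j0] := posnP j; last by rewrite g0 ?mulr0 // j0.
    rewrite j0 take0 (@eq_gap _ (fun=> 1)) ?gap_const ?mulr0 // => t.
    by rewrite /node_poly big_nil hornerC.
  by move=> t; rewrite hornerD hornerZ.
move=> k km; have [D [g hg]] := @posdef_exp R n (2 * k).
have [c hc] := z_design km.
have : gap (fun t => t ^+ (2 * k)) = 0.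
  rewrite -(gp 'X^k m (leqnn m)) ?size_polyXn //.
  by apply: eq_gap => t; rewrite hornerXn exprM.
rewrite /gap (pair_sum_gap xS zS N0 W1 hg hc) => /eqP.
rewrite psumr_eq0 => [/allP h|d _]; last exact: sqr_ge0.
have {}h d : \sum_i W i * g d (x i) = avg z (g d).
  have /h : d \in index_enum D by rewrite mem_index_enum.
  by rewrite /= sqrf_eq0 subr_eq0 => /eqP.
exists c => u hu; rewrite -(hc u hu).
transitivity (\sum_d g d u * \sum_i W i * g d (x i)).
  under [RHS]eq_bigr do rewrite big_distrr.
  rewrite exchange_big; apply: eq_bigr => i _ /=.
  by rewrite hg // big_distrr; apply: eq_bigr => d _ /=; ring.
under eq_bigr do rewrite h -avgZ.
by rewrite -avg_sum; apply: eq_avg => j; rewrite hg.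
Qed.

Lemma energy_eq_conclusion :
  (forall k (t : R), (0 < k <= m)%N -> 0 < t < 1 -> 0 < f^`(k)%classic t) ->
  E = E' ->
  [/\ forall i, W i = N%:R^-1, forall i j, i != j -> dotv (x i) (x j) \in A
    & even_design (m := m) x].
Proof.
move=> f_gt0 EE.
have [la [sl [[D hla hsl] sl0]]] := energy_decomposition.
have sl_gt0 s : 0 <= s <= 1 -> s \notin ns -> 0 < sl s.
  move=> hs sn; have [xi hxi [c c0 ->]] := hsl s hs sn.
  by rewrite mulr_gt0 // f_gt0 // m0 leqnn.
have sl_ge0 s : 0 <= s <= 1 -> 0 <= sl s.
  by move=> hs; have [/sl0->//|/(sl_gt0 s hs)/ltW] := boolP (s \in ns).
have g0 : gap (fun t => (node_poly (take 0 ns)).[t ^+ 2]) = 0.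
  rewrite take0 (@eq_gap _ (fun=> 1)) ?gap_const // => t.
  by rewrite /node_poly big_nil hornerC.
have la_gt0 k : (0 < k < m)%N -> 0 < la k.
  move=> hk; have [xi hxi ->] := hla k hk.
  by rewrite divr_gt0 ?ltr0n ?fact_gt0 // f_gt0 //; case/andP: hk => -> /ltnW.
have t1 k : (k < m)%N ->
    0 <= la k * gap (fun t => (node_poly (take k ns)).[t ^+ 2]).
  move=> km; have [->|k0] := posnP k; first by rewrite g0 mulr0.
  by rewrite mulr_ge0 ?gap_node_ge0 // ltW // la_gt0 // k0.
have t2 i j : j != i -> 0 <= W i * W j * sl (dotv (x i) (x j) ^+ 2).
  by move=> ji; rewrite mulr_ge0 ?sl_ge0 ?x_dots_sqr 1?eq_sym // mulr_ge0 // ltW.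
have t3 : 0 <= sl 1 * \sum_i (W i - N%:R^-1) ^+ 2.
  rewrite mulr_ge0 ?sl_ge0 ?ler01 ?lexx //.
  by apply: sumr_ge0 => i _; rewrite sqr_ge0.
move/eqP: D; rewrite EE subrr eq_sym paddr_eq0; last 2 first.
- by apply: sumr_ge0 => k _; apply: t1.
- by apply: addr_ge0 => //; apply: sumr_ge0 => i _; apply: sumr_ge0 => j; apply: t2.
rewrite paddr_eq0 //; last by apply: sumr_ge0 => i _; apply: sumr_ge0 => j; apply: t2.
rewrite psumr_eq0 => [|k _]; last exact: t1.
rewrite psumr_eq0 => [|i _]; last by apply: sumr_ge0 => j; apply: t2.
move=> /and3P[/allP z1 /allP z2 z3].
have WN i : W i = N%:R^-1.
  move: z3; rewrite mulf_eq0 gt_eqF ?sl_gt0 ?ler01 ?lexx ?one_notin_nodes //=.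
  rewrite psumr_eq0 => [/allP h|k _]; last exact: sqr_ge0.
  have /h : i \in index_enum 'I_N by rewrite mem_index_enum.
  by rewrite /= sqrf_eq0 subr_eq0 => /eqP.
split=> //.
  move=> i j ij; have /z2 : i \in index_enum 'I_N by rewrite mem_index_enum.
  rewrite /= psumr_eq0 => [/allP h|k]; last exact: t2.
  have /h : j \in index_enum 'I_N by rewrite mem_index_enum.
  rewrite eq_sym ij /= !mulf_eq0 !(gt_eqF (W0 _)) /= => s0.
  rewrite -mem_hermite_nodes //; apply: contraT => sn.
  by have := sl_gt0 _ (x_dots_sqr ij) sn; rewrite (eqP s0) ltxx.
move=> k km; have [|c hc] := even_design_of_gap_eq0 _ km.
  move=> j hj; have jm : (j < m)%N by case/andP: hj.
  have /z1 : Ordinal jm \in index_enum 'I_m by rewrite mem_index_enum.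
  by rewrite /= mulf_eq0 gt_eqF ?la_gt0 //= => /eqP.
exists c => u hu; rewrite -(hc u hu) avgE.
by apply: eq_bigr => i _; rewrite WN.
Qed.

End Core.

(** * Antipodal codes *)

Section Antipodal.
Context {R : realType} {n N : nat}.
Implicit Types (X : 'M[R]_(N, n)) (w : 'rV[R]_N).

Lemma row_antipodal_l X i : row (lshift N i) (col_mx X (- X)) = row i X.
Proof. by rewrite rowKu. Qed.

Lemma row_antipodal_r X i : row (rshift N i) (col_mx X (- X)) = - row i X.
Proof. by rewrite rowKd linearN. Qed.

Definition row_antipodal := (row_antipodal_l, row_antipodal_r).

Lemma energy_antipodal (f : R -> R) X w :
  energy f (col_mx X (- X)) (row_mx w w) =
  4 * \sum_i \sum_j w 0 i * w 0 j * f (dotv (row i X) (row j X) ^+ 2).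
Proof.
have half (g : 'rV[R]_n -> R) : (forall v, g (- v) = g v) ->
    \sum_j row_mx w w 0 j * g (row j (col_mx X (- X))) =
    2 * \sum_i w 0 i * g (row i X).
  move=> gN; rewrite big_split_ord /= mulr_natl mulr2n; congr (_ + _).
    by apply: eq_bigr => i _; rewrite row_mxEl row_antipodal.
  by apply: eq_bigr => i _; rewrite row_mxEr row_antipodal gN.
pose G u := \sum_j row_mx w w 0 j * f (dotv u (row j (col_mx X (- X))) ^+ 2).
have GN u : G (- u) = G u by apply: eq_bigr => j _; rewrite dotvNl sqrrN.
transitivity (\sum_i row_mx w w 0 i * G (row i (col_mx X (- X)))).
  by apply: eq_bigr => i _; rewrite big_distrr; apply: eq_bigr => j _ /=; rewrite mulrA.
rewrite half // (_ : 4 = 2 * 2) -?mulrA; last by ring.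
congr (_ * _); rewrite big_distrr; apply: eq_bigr => i _.
rewrite /G (half (fun v => f (dotv (row i X) v ^+ 2))) => [|v]; last first.
  by rewrite dotvNr sqrrN.
rewrite mulrCA big_distrr; congr (_ * _); apply: eq_bigr => j _ /=.
by rewrite mulrA.
Qed.

Lemma weighted_code_antipodal X w :
  weighted_code (col_mx X (- X)) (row_mx w w) ->
  [/\ forall i, sphere (row i X),
      forall i j, i != j -> -1 < dotv (row i X) (row j X) < 1,
      forall i, 0 < w 0 i & \sum_i 2 * w 0 i = 1].
Proof.
move=> [sph inj pos sum1].
have XS i : sphere (row i X) by rewrite -row_antipodal_l.
split=> //.
- move=> i j ij; apply: sphere_dot_lt1 => //.
    rewrite -!row_antipodal_l => /inj /lshift_inj /eqP.
    by rewrite (negPf ij).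
  rewrite -row_antipodal_l -row_antipodal_r => /inj /eqP.
  by rewrite eq_lrshift.
- by move=> i; have := pos (lshift N i); rewrite row_mxEl.
rewrite -[RHS]sum1 big_split_ord /= -big_split; apply: eq_bigr => i _ /=.
by rewrite row_mxEl row_mxEr; ring.
Qed.

Lemma sum_antipodal X w (p : {poly R}) (x : 'rV[R]_n) :
  \sum_i row_mx w w 0 i * p.[dotv x (row i (col_mx X (- X)))] =
  \sum_i w 0 i * (p.[dotv x (row i X)] + p.[- dotv x (row i X)]).
Proof.
rewrite big_split_ord /= -big_split; apply: eq_bigr => i _ /=.
by rewrite row_mxEl row_mxEr !row_antipodal dotvNr mulrDr.
Qed.

Lemma const_row_mx (c : R) :
  const_mx c = row_mx (const_mx c) (const_mx c) :> 'rV[R]_(N + N).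
Proof. by rewrite row_mx_const. Qed.

(** Odd powers average to zero over an antipodal code, so the strength
    [2 m - 1] only asks for the even powers up to [2 m - 2]. *)
Lemma is_design_antipodalP X m : (0 < m)%N -> (0 < N)%N ->
  is_design (2 * m - 1) (col_mx X (- X)) (const_mx (2 * N)%:R^-1 : 'rV[R]_(N + N))
  <-> even_design (m := m) (fun i => row i X).
Proof.
move=> m0 N0; have Nn : (N%:R : R) != 0 by rewrite pnatr_eq0 -lt0n.
rewrite const_row_mx; split=> [dsg k km|dsg p].
  have [|c hc] := dsg 'X^(2 * k); first by rewrite size_polyXn; lia.
  exists c => x /hc <-; rewrite sum_antipodal avgE; apply: eq_bigr => i _.
  by rewrite !hornerXn mxE natrM !exprM sqrrN; field.
move=> sp; have /choice[c hc] (k : nat) : exists c, (k < m)%N ->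
    forall x, sphere x -> avg (fun i => row i X) (fun v => dotv x v ^+ (2 * k)) = c.
  have [km|] := boolP (k < m)%N; last by exists 0.
  by have [c hc] := dsg k km; exists c.
exists (\sum_(k < 2 * m) if odd k then 0 else p`_k * c k./2) => x hx.
rewrite sum_antipodal.
transitivity (avg (fun i => row i X) (fun v => \sum_(k < 2 * m)
   p`_k * ((dotv x v ^+ k + (- dotv x v) ^+ k) / 2))).
  rewrite avgE; apply: eq_bigr => i _; rewrite mxE.
  have hp t : p.[t] = \sum_(k < 2 * m) p`_k * t ^+ k.
    by apply: horner_coef_wide; apply: leq_trans sp _; lia.
  rewrite !hp -big_split natrM invfM -mulrA mulrCA; congr (_ * _).
  by rewrite big_distrr; apply: eq_bigr => k _ /=; ring.
rewrite avg_sum; apply: eq_bigr => k _; rewrite avgZ; case: ifP => ok.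
  rewrite /avg big1 ?mulr0 // => i _.
  by rewrite exprNn -signr_odd ok expr1 mulN1r subrr mul0r.
congr (_ * _); rewrite -(hc k./2 _ x hx); last by have := ltn_ord k; lia.
apply: eq_avg => i.
have -> : (2 * k./2)%N = k by rewrite mul2n -[RHS]odd_double_half ok.
by rewrite exprNn -signr_odd ok expr0 mul1r; field.
Qed.

End Antipodal.

Local Open Scope classical_set_scope.

Theorem corollary7p6 (R : realType) (n m N : nat)
    (hn : (2 <= n)%N) (hm : (1 <= m)%N) (hN : (1 <= N)%N)
    (A : m.-tuple R)
    (A_sorted : sorted <%R A)
    (A_range : forall a, a \in A -> -1 < a < 1)
    (A_sym : forall a, a \in A -> - a \in A)
    (X' : 'M[R]_(N, n))
    (hX' : antipodal_equi_weighted_design (2 * m - 1) A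
             (col_mx X' (- X')) (const_mx (2 * N)%:R^-1 : 'rV[R]_(N + N)))
    (f : R -> R)
    (f_cont : {within `[0, 1], continuous f})
    (f_deriv : forall (k : nat) (t : R), (1 <= k <= m)%N -> 0 < t < 1 ->
       derivable (f^`(k.-1)) t 1 /\ 0 <= (f^`(k)) t)
    (X : 'M[R]_(N, n)) (w : 'rV[R]_N)
    (hXw : weighted_code (col_mx X (- X)) (row_mx w w))
    (hXw_antipodal : antipodal (col_mx X (- X)) (row_mx w w)) :
  let E := energy f (col_mx X (- X)) (row_mx w w) in
  let E' := energy f (col_mx X' (- X'))
              (const_mx (2 * N)%:R^-1 : 'rV[R]_(N + N)) in
  [/\ E = 4 * \sum_(i < N) \sum_(j < N)
            w 0 i * w 0 j * f (dotv (row i X) (row j X) ^+ 2),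
      E' = (N ^ 2)%:R^-1 * \sum_(i < N) \sum_(j < N)
            f (dotv (row i X') (row j X') ^+ 2),
      E >= E'
    & (forall (k : nat) (t : R), (1 <= k <= m)%N -> 0 < t < 1 ->
         0 < (f^`(k)) t) ->
      (E = E' <->
       antipodal_equi_weighted_design (2 * m - 1) A
         (col_mx X (- X)) (row_mx w w))].
Proof.
move=> E E'.
have Nn : (N%:R : R) != 0 by rewrite pnatr_eq0 -lt0n.
have EE : E = 4 * \sum_(i < N) \sum_(j < N)
    w 0 i * w 0 j * f (dotv (row i X) (row j X) ^+ 2) by exact: energy_antipodal.
have EE' : E' = (N ^ 2)%:R^-1 * \sum_(i < N) \sum_(j < N)
    f (dotv (row i X') (row j X') ^+ 2).
  rewrite /E' const_row_mx energy_antipodal !big_distrr; apply: eq_bigr => i _ /=.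
  rewrite !big_distrr; apply: eq_bigr => j _ /=.
  by rewrite !mxE natrX natrM; field.
have [code' anti' _ dsg' dots'] := hX'.
have [XS' Xd' _ _] : [/\ forall i, sphere (row i X'),
      forall i j, i != j -> -1 < dotv (row i X') (row j X') < 1,
      forall i, 0 < (const_mx (2 * N)%:R^-1 : 'rV[R]_N) 0 i &
      \sum_i 2 * (const_mx (2 * N)%:R^-1 : 'rV[R]_N) 0 i = 1].
  by apply: weighted_code_antipodal; rewrite -const_row_mx.
have [XS Xd w0 w1] := weighted_code_antipodal hXw.
have design_dots (Y : 'M[R]_(N, n)) :
    (forall i j, i != j -> -1 < dotv (row i Y) (row j Y) < 1) ->
    (forall i, sphere (row i Y)) ->
    distinct_pair_dots_in A (col_mx Y (- Y)) ->
    forall i j, i != j -> dotv (row i Y) (row j Y) \in A.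
  move=> Yd YS dots i j ij; have := dots (lshift N i) (lshift N j).
  rewrite !row_antipodal_l; apply=> ij'; have := Yd i j ij; rewrite ij' ?dotvNl.
    by have := YS j; rewrite /sphere /= => ->; rewrite ltxx andbF.
  by have := YS j; rewrite /sphere /= => ->; rewrite ltxx.
have D' := design_dots X' Xd' XS' dots'.
have even' : even_design (m := m) (fun i => row i X') by apply/is_design_antipodalP.
have fder k (t : R) : (k < m)%N -> 0 < t < 1 -> is_derive t 1 (f^`(k)) (f^`(k.+1) t).
  move=> km ht; have [|d _] := f_deriv k.+1 t _ ht; first by [].
  by rewrite derive1nS derive1E; apply: derivableP.
have f_ge0 k (t : R) : (0 < k <= m)%N -> 0 < t < 1 -> 0 <= f^`(k) t.
  by move=> km ht; have [] := f_deriv k t km ht.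
have u0 (i : 'I_N) : 0 < (N%:R^-1 : R) by rewrite invr_gt0 ltr0n.
have u1 : \sum_(i < N) (N%:R^-1 : R) = 1.
  by rewrite sumr_const card_ord -[_ *+ N]mulr_natl mulfV.
have W0 i : 0 < 2 * w 0 i by rewrite mulr_gt0.
have PE : E = pair_sum (fun i => 2 * w 0 i) (fun i => row i X) (fun t => f (t ^+ 2)).
  rewrite EE big_distrr; apply: eq_bigr => i _; rewrite big_distrr.
  by apply: eq_bigr => j _ /=; ring.
have PE' : E' = pair_sum (fun=> N%:R^-1) (fun i => row i X') (fun t => f (t ^+ 2)).
  rewrite EE' big_distrr; apply: eq_bigr => i _; rewrite big_distrr.
  by apply: eq_bigr => j _ /=; rewrite natrX; field.
have sz : size A = m by exact: size_tuple.
split=> //.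
  rewrite PE PE'; exact: (energy_ge hn hm hN A_sorted A_range A_sym sz XS' even' D'
    f_cont fder f_ge0 XS Xd W0 w1).
move=> f_gt0; split=> [EQ|[code anti equi dsg dots]].
  rewrite PE PE' in EQ.
  have [WN Ad ev] := energy_eq_conclusion hn hm hN A_sorted A_range A_sym sz XS' even' D'
    f_cont fder XS Xd W0 w1 f_gt0 EQ.
  have wE : row_mx w w = const_mx (2 * N)%:R^-1.
    rewrite const_row_mx; suff -> : w = const_mx (2 * N)%:R^-1 by [].
    by apply/rowP => i; rewrite mxE natrM invfM -(WN i); field.
  split=> //.
  - by move=> i; rewrite wE mxE mul2n addnn.
  - by rewrite wE; apply/is_design_antipodalP.
  move=> i j; rewrite -(fintype.splitK i) -(fintype.splitK j).
  case: (fintype.split i) => i'; case: (fintype.split j) => j' /=; rewrite !row_antipodal.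
  - move=> a b; apply: Ad; by apply/eqP => ij; apply: a; rewrite ij.
  - move=> a b; rewrite dotvNr; apply/A_sym/Ad.
    by apply/eqP => ij; apply: b; rewrite ij opprK.
  - move=> a b; rewrite dotvNl; apply/A_sym/Ad.
    by apply/eqP => ij; apply: b; rewrite ij.
  - move=> a b; rewrite dotvNl dotvNr opprK; apply: Ad.
    by apply/eqP => ij; apply: a; rewrite ij.
have wN i : 2 * w 0 i = N%:R^-1.
  have := equi (lshift N i); rewrite row_mxEl => ->.
  by rewrite addnn -mul2n natrM; field.
have even : even_design (m := m) (fun i => row i X).
  apply/is_design_antipodalP => //.
  suff -> : const_mx (2 * N)%:R^-1 = row_mx w w by [].
  by apply/rowP => i; rewrite mxE equi mul2n addnn.
have D := design_dots X Xd XS dots.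
(* both codes are designs with dot products in A: each has energy at least that
   of the other *)
apply/eqP; rewrite eq_le; apply/andP; split; last first.
  rewrite PE PE'; exact: (energy_ge hn hm hN A_sorted A_range A_sym sz XS' even' D'
    f_cont fder f_ge0 XS Xd W0 w1).
have -> : E = pair_sum (fun=> N%:R^-1) (fun i => row i X) (fun t => f (t ^+ 2)).
  by rewrite PE; apply: eq_bigr => i _; apply: eq_bigr => j _; rewrite !wN.
rewrite PE'; exact: (energy_ge hn hm hN A_sorted A_range A_sym sz XS even D
    f_cont fder f_ge0 XS' Xd' u0 u1).
Qed.
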